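(* Let $(X_t)_{t\ge 0}$ be a Feller process in $\mathbb{R}^d$ whose generator $(A,D(A))$ satisfies $C_c^\infty(\mathbb{R}^d)\subset D(A)$, and let $p(x,\xi)$ be its symbol. Assume that there is a constant $c_0>0$ such that $\sup_{x\in\mathbb{R}^d}|p(x,\xi)|\le c_0(1+|\xi|^2)$ for all $\xi\in\mathbb{R}^d$, and that $p(x,0)=0$ for all $x\in\mathbb{R}^d$. Suppose that $(X_t)_{t\ge 0}$ has a transition probability density $p(t,x,y)$, and that there are $\alpha\in(0,2)$ and a constant $c>0$ with $$p(t,x,y)\le c\,t^{-d/\alpha}\qquad\text{for all } t\in(0,1],\ x,y\in\mathbb{R}^d.$$ Then, for every analytic set $E\subset[0,1]$ and every starting point $x\in\mathbb{R}^d$, $$\dim_{\mathrm H}X(E)\ \ge\ (\alpha\wedge d)\,\dim_{\mathrm H}E\qquad \mathbb{P}^x\text{-almost surely}.$$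
   Context: A Feller process with state space $\mathbb{R}^d$ is a strong Markov process $(X_t)_{t\ge0}$, with laws $\mathbb{P}^x$ and expectations $\mathbb{E}^x$ for the starting point $x\in\mathbb{R}^d$, such that the operators $T_tu(x)=\mathbb{E}^x(u(X_t))$ map $C_\infty(\mathbb{R}^d)$ (continuous functions vanishing at infinity) into itself and form a strongly continuous sub-Markovian contraction semigroup on $C_\infty(\mathbb{R}^d)$ with the uniform norm. As usual, the sample paths are taken to be càdlàg. Its generator is $Au=\lim_{t\to0}(T_tu-u)/t$ (limit in the uniform norm), with domain $D(A)$ the set of all $u\in C_\infty(\mathbb{R}^d)$ for which the limit exists. If $C_c^\infty(\mathbb{R}^d)\subset D(A)$ (smooth compactly supported functions), then $Au(x)=-\int e^{i\langle x,\xi\rangle}p(x,\xi)\hat u(\xi)\,d\xi$ for $u\in C_c^\infty(\mathbb{R}^d)$, where $\hat u(\xi)=(2\pi)^{-d}\int e^{-i\langle x,\xi\rangle}u(x)\,dx$. The function $p:\mathbb{R}^d\times\mathbb{R}^d\to\mathbb{C}$ is called the symbol; it is locally bounded, measurable in $x$, and for each fixed $x$ continuous and negative definite in $\xi$ (i.e. given by a Lévy–Khintchine formula with $x$-dependent characteristics). The symbol $p(x,\xi)$ (two arguments) is not to be confused with the transition density $p(t,x,y)$ (three arguments), which means $\mathbb{P}^x(X_t\in B)=\int_B p(t,x,y)\,dy$ for all $t>0$, $x\in\mathbb{R}^d$ and Borel sets $B\subset\mathbb{R}^d$. $\dim_{\mathrm H}$ denotes Hausdorff dimension, $\alpha\wedge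 d=\min\{\alpha,d\}$, and $X(E)=X(E,\omega)=\{X_t(\omega):t\in E\}$. *)

(* Defs.v *)
From HB Require Import structures.
From mathcomp Require Import all_boot all_order all_algebra.
From mathcomp Require Import all_classical all_reals all_analysis.
From mathcomp Require Import measurable_realfun.
From mathcomp Require Import complex.

Set Implicit Arguments.
Unset Strict Implicit.
Unset Printing Implicit Defensive.
Import Order.TTheory GRing.Theory Num.Theory.
Import numFieldNormedType.Exports.
Local Open Scope classical_set_scope.
Local Open Scope ring_scope.

(* R^d with its Borel sigma-algebra *)
Notation borelRV R d := (g_sigma_algebraType (@open 'rV[R]_d)).

Section lebesgue_rV.
Context {R : realType}.

Lemma measurable_ball_rV d (x : 'rV[R]_d) (r : R) :
  measurable (ball x r : set (borelRV R d)).
Proof.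
have [r0|r0] := ltP 0 r.
  by apply: sub_sigma_algebra; apply: ball_open.
by rewrite le0_ball0//; exact: measurable0.
Qed.

Definition cons_rV d (z : measurableTypeR R * borelRV R d) : borelRV R d.+1 :=
  row_mx (z.1)%:M z.2.

Lemma cons_rV_ball d (x : 'rV[R]_d.+1) (r : R) :
  @cons_rV d @^-1` ball x r =
  ball (x 0 0) r `*` ball (\row_j x 0 (lift 0 j)) r.
Proof.
have xl (j : 'I_d) : @rshift 1 d j = lift 0 j by exact/val_inj.
have x0 (j : 'I_1) : @lshift 1 d j = 0 by rewrite ord1; exact/val_inj.
apply/seteqP; split => -[t v] /=; rewrite /cons_rV /=.
  move=> [r0 h]; split.
    by have := h 0 (@lshift 1 d 0); rewrite (row_mxEl t%:M v 0 0) x0 mxE eqxx mulr1n.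
  split=> // i j; rewrite mxE.
  by have := h 0 (@rshift 1 d j); rewrite (row_mxEr t%:M v 0 j) xl ord1.
move=> [h0 [r0 h]]; split=> // i j; rewrite ord1.
have [k|k] := @split_ordP 1 d j => ->.
  by rewrite (row_mxEl t%:M v 0 k) x0 mxE ord1 eqxx mulr1n.
by rewrite (row_mxEr t%:M v 0 k) xl; have := h 0 k; rewrite mxE.
Qed.

Lemma open_rV_bigcup_ball d (U : set 'rV[R]_d) : open U ->
  exists F : ('rV[rat]_d * nat) -> set 'rV[R]_d, U = \bigcup_k F k /\
    forall k, F k = set0 \/ exists x r, F k = ball x r.
Proof.
move=> oU.
pose B (k : 'rV[rat]_d * nat) : set 'rV[R]_d :=
  ball (map_mx ratr k.1 : 'rV[R]_d) (k.2.+1%:R^-1 : R).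
exists (fun k => if pselect (B k `<=` U) then B k else set0); split; last first.
  move=> k; case: pselect => h; last by left.
  by right; exists (map_mx ratr k.1), k.2.+1%:R^-1.
apply/seteqP; split => [x Ux|x [k _]]; last by case: pselect => //= s /s.
have /nbhs_ballP[e /= e0 xe] : nbhs x U by exact: open_nbhs_nbhs.
have [n ne] : exists n : nat, n.+1%:R^-1 < e / 2.
  have e2 : 0 < e / 2 by rewrite divr_gt0.
  have [n _ /(_ n (leqnn n))] := near_infty_natSinv_lt (PosNum e2).
  by exists n.
have n0 : (0 : R) < n.+1%:R^-1 by rewrite invr_gt0.
have qP j : exists q : rat, ratr q \in `](x 0 j - n.+1%:R^-1), (x 0 j + n.+1%:R^-1)[.
  by apply: rat_in_itvoo; rewrite ltrD2l gt0_cp.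
pose q : 'rV[rat]_d := \row_j sval (cid (qP j)).
have qx j : `|x 0 j - ratr (q 0 j)| < n.+1%:R^-1.
  rewrite mxE; case: cid => y /=; rewrite in_itv/= => /andP[h1 h2].
  by rewrite ltr_norml ltrNl opprB ltrBlDl h2 ltrBlDr -ltrBlDl h1.
exists (q, n) => //=; case: pselect => [h|h].
  by split=> // i j; rewrite ord1 mxE /ball/= distrC; exact: qx.
case: h => y [_ h]; apply: xe; split=> // i j.
have := h i j; rewrite ord1 mxE /ball/= => h'.
rewrite (_ : x 0 j - y 0 j = (x 0 j - ratr (q 0 j)) + (ratr (q 0 j) - y 0 j)); last by rewrite addrA subrK.
by rewrite (le_lt_trans (ler_normD _ _))// (splitr e) ltrD// (lt_trans _ ne).
Qed.

Lemma measurable_cons_rV d : measurable_fun setT (@cons_rV d).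
Proof.
apply: (@measurability _ _ _ (borelRV R d.+1) setT (@cons_rV d) (@open 'rV[R]_d.+1)) => //.
move=> _ [U /open_rV_bigcup_ball [F [-> hF]] <-]; rewrite setTI preimage_bigcup.
apply: countable_bigcupT_measurable; first exact: countableP.
move=> k; have [->|[x [r ->]]] := hF k; first by rewrite preimage_set0; exact: measurable0.
rewrite cons_rV_ball; apply: measurableX; first exact: measurable_realfun.measurable_ball.
exact: measurable_ball_rV.
Qed.

Section sfin.
Variables (d : nat) (m : {measure set (borelRV R d) -> \bar R}).
Hypothesis mfin : forall r : R, (m (ball (0%R : 'rV[R]_d) r) < +oo)%E.

Definition lfin_measure 
    (_ : forall r : R, (m (ball (0%R : 'rV[R]_d) r) < +oo)%E) :
  set (borelRV R d) -> \bar R := m.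
Local Notation m' := (lfin_measure mfin).
HB.instance Definition _ := Measure.on m'.

Let m'_sigma_finite : sigma_finite setT m'.
Proof.
exists (fun n => ball (0%R : 'rV[R]_d) n%:R); last first.
  by move=> n; split; [exact: measurable_ball_rV|exact: mfin].
apply/seteqP; split => // x _; exists (Num.truncn `|x|).+1 => //.
rewrite -ball_normE /ball_ /= sub0r normrN.
exact: truncnS_gt.
Qed.

HB.instance Definition _ := Measure_isSigmaFinite.Build _ _ _ m' m'_sigma_finite.

End sfin.

Section step.
Variables (d : nat) (m : {measure set (borelRV R d) -> \bar R}).
Hypothesis mfin : forall r : R, (m (ball (0%R : 'rV[R]_d) r) < +oo)%E.
Local Notation m' := (lfin_measure mfin).

Definition lebesgue_rV_step (A : set (borelRV R d.+1)) : \bar R :=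
  (lebesgue_measure \x m')%E (@cons_rV d @^-1` A).

Let step0 : lebesgue_rV_step set0 = 0%E.
Proof. rewrite /lebesgue_rV_step preimage_set0; exact: (measure0 (lebesgue_measure \x m')%E). Qed.

Let step_ge0 A : (0 <= lebesgue_rV_step A)%E.
Proof. exact: (measure_ge0 (lebesgue_measure \x m')%E). Qed.

Let step_sigma_additive : semi_sigma_additive lebesgue_rV_step.
Proof.
move=> F mF tF mUF; rewrite /lebesgue_rV_step preimage_bigcup.
have mcons (A : set (borelRV R d.+1)) : measurable A ->
    measurable (@cons_rV d @^-1` A).
  by move=> mA; rewrite -[X in measurable X]setTI; exact: measurable_cons_rV.
apply: measure_semi_sigma_additive.
- by move=> n; exact: mcons.
- apply/trivIsetP => /= i j _ _ ij; rewrite -preimage_setI.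
  by move/trivIsetP : tF => /(_ _ _ _ _ ij) ->//; rewrite preimage_set0.
- by rewrite -preimage_bigcup; exact: mcons.
Qed.

HB.instance Definition _ := isMeasure.Build _ _ _ lebesgue_rV_step
  step0 step_ge0 step_sigma_additive.

Lemma lebesgue_rV_stepE (A : set R) (B : set (borelRV R d)) (C : set (borelRV R d.+1)) :
  measurable A -> measurable B -> @cons_rV d @^-1` C = A `*` B ->
  lebesgue_rV_step C = (lebesgue_measure A * m B)%E.
Proof. by move=> mA mB; rewrite /lebesgue_rV_step => ->; exact: product_measure1E. Qed.

Lemma lebesgue_rV_step_fin (r : R) :
  (lebesgue_rV_step (ball (0%R : 'rV[R]_d.+1) r) < +oo)%E.
Proof.
rewrite (lebesgue_rV_stepE _ _ (cons_rV_ball _ _)).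
- rewrite mxE (_ : \row_j _ = 0); last by apply/rowP => j; rewrite !mxE.
  rewrite lte_mul_pinfty//.
  have [r0|r0] := leP 0 r; first by rewrite lebesgue_measure_ball// ltry.
  by rewrite le0_ball0 ?measure0// ltW.
- exact: measurable_realfun.measurable_ball.
- exact: measurable_ball_rV.
Qed.
End step.

Let lebesgue_rV0 : {measure set (borelRV R 0) -> \bar R} :=
  dirac (0%R : borelRV R 0).

Let lebesgue_rV0_fin (r : R) : (lebesgue_rV0 (ball (0%R : 'rV[R]_0) r) < +oo)%E.
Proof.
by rewrite (le_lt_trans (probability_le1 (dirac _) _)) ?ltry//; exact: measurable_ball_rV.
Qed.

(* Lebesgue measure on R^d, as the d-fold product of the Lebesgue measure on R;
   [lebesgue_rV_box] below is its usual characterization. Finiteness on balls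
   is carried along because the product needs sigma-finite factors. *)
Fixpoint lebesgue_rV_sig d : {m : {measure set (borelRV R d) -> \bar R} |
    forall r : R, (m (ball (0%R : 'rV[R]_d) r) < +oo)%E} :=
  match d with
  | 0 => exist _ lebesgue_rV0 lebesgue_rV0_fin
  | d'.+1 =>
    let mfin := svalP (lebesgue_rV_sig d') in
    exist _ (lebesgue_rV_step mfin : {measure set _ -> \bar R})
      (lebesgue_rV_step_fin mfin)
  end.

Definition lebesgue_rV d : {measure set (borelRV R d) -> \bar R} :=
  sval (lebesgue_rV_sig d).

Lemma lebesgue_rV_box d (a b : 'rV[R]_d) : (forall i, a 0 i <= b 0 i) ->
  lebesgue_rV d [set x | forall i, a 0 i <= x 0 i <= b 0 i] =
  (\prod_i (b 0 i - a 0 i))%:E.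
Proof.
have mbox n (u v : 'rV[R]_n) : measurable ([set x | forall i, u 0 i <= x 0 i <= v 0 i] : set (borelRV R n)).
  rewrite [X in measurable X](_ : _ = \bigcap_(i in [set: 'I_n]) [set x : 'rV[R]_n | u 0 i <= x 0 i <= v 0 i]); last first.
    by apply/seteqP; split => x /=; [move=> h i _|move=> h i]; exact: h.
  apply: fin_bigcap_measurable => // i _.
  rewrite [X in measurable X](_ : _ = ~` (~` ((fun x : 'rV[R]_n => x 0 i) @^-1` `[u 0 i, v 0 i]))); last first.
    by rewrite setCK; apply/seteqP; split => x /=; rewrite in_itv.
  apply: measurableC; apply: sub_sigma_algebra; rewrite /= openC.
  apply: preimage_closed; last exact: interval_closed.
  by move=> x _; exact: coord_continuous.
elim: d a b => [|d IH] a b ab.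
  by rewrite big_ord0 /lebesgue_rV/= /lebesgue_rV0 /= diracE mem_set//= => -[].
pose tl (u : 'rV[R]_d.+1) : 'rV[R]_d := \row_j u 0 (lift 0 j).
have xl (j : 'I_d) : @rshift 1 d j = lift 0 j by exact/val_inj.
have x0 : @lshift 1 d 0 = 0 by exact/val_inj.
rewrite /lebesgue_rV/= (@lebesgue_rV_stepE _ _ _ `[a 0 0, b 0 0]%classic
  [set x | forall i, tl a 0 i <= x 0 i <= tl b 0 i])//; last first.
- apply/seteqP; split => -[t v] /=; rewrite /cons_rV /= in_itv/=.
    move=> h; split.
      by have := h 0; rewrite -x0 (row_mxEl t%:M v 0 0) mxE eqxx mulr1n x0.
    by move=> i; have := h (lift 0 i); rewrite -xl (row_mxEr t%:M v 0 i) xl !mxE.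
  move=> [h0 h] i; have [k|k] := @split_ordP 1 d i => ->.
    by rewrite (row_mxEl t%:M v 0 k) ord1 x0 mxE eqxx mulr1n.
  by rewrite (row_mxEr t%:M v 0 k) xl; have := h k; rewrite !mxE.
- rewrite -/(lebesgue_rV d) IH; last by move=> i; rewrite !mxE.
  rewrite lebesgue_measure_itv/= lte_fin big_ord_recl EFinM; congr (_ * _)%E.
    by case: ltgtP (ab 0) => //= [->]; rewrite subrr.
  by congr (_%:E); apply: eq_bigr => i _; rewrite !mxE.
Qed.

End lebesgue_rV.

Section euclidean.
Context {R : realType} {d : nat}.
Implicit Types x y : 'rV[R]_d.

Definition dotrV x y : R := \sum_i x 0 i * y 0 i.

(* The library norm of 'rV[R]_d is the sup norm; it induces the same topology. *)
Definition enorm x : R := Num.sqrt (dotrV x x).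

Definition Cinfty (u : 'rV[R]_d -> R) : Prop :=
  continuous u /\
  forall e : R, 0 < e -> exists M : R, forall x, M < enorm x -> `|u x| < e.

Fixpoint Ck (k : nat) (u : 'rV[R]_d -> R) : Prop :=
  match k with
  | 0 => continuous u
  | k'.+1 => continuous u /\ forall i : 'I_d,
      (forall x, derivable u x (delta_mx 0 i)) /\
      Ck k' (fun x => 'D_(delta_mx 0 i) u x)
  end.

Definition Cc_smooth (u : 'rV[R]_d -> R) : Prop :=
  (forall k, Ck k u) /\ compact (closure [set x | u x != 0]).

End euclidean.

Section negative_definite.
Context {R : realType} {d : nat}.
Local Open Scope complex_scope.

Definition cintegral d' (T : measurableType d')
    (mu : {measure set T -> \bar R}) (f : T -> R[i]) : R[i] :=
  (\int[mu]_y complex.Re (f y)) +i* (\int[mu]_y complex.Im (f y)).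

(* [cis t] is exp(i t) *)
Definition cis (t : R) : R[i] := cos t +i* sin t.

Definition fourier (u : 'rV[R]_d -> R) (xi : 'rV[R]_d) : R[i] :=
  (((2 * pi) ^- d)%:C *
    cintegral (lebesgue_rV d) (fun x => cis (- dotrV x xi) * (u x)%:C))%R.

(* Levy-Khintchine formula with killing rate a, drift b, diffusion matrix Q and
   Levy measure nu *)
Definition levy_khintchine (psi : 'rV[R]_d -> R[i]) : Prop :=
  exists (a : R) (b : 'rV[R]_d) (Q : 'M[R]_d)
    (nu : {measure set (borelRV R d) -> \bar R}),
  [/\ 0 <= a,
      Q^T = Q /\ (forall xi, 0 <= dotrV xi (xi *m Q)),
      nu [set 0] = 0%E,
      (\int[nu]_y (Num.min 1 (enorm y ^+ 2))%:E < +oo)%E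
    & forall xi, psi xi =
        (a%:C - (0 +i* 1) * (dotrV b xi)%:C + (dotrV xi (xi *m Q) / 2)%:C
         + cintegral nu (fun y => 1 - cis (dotrV y xi) +
             (0 +i* 1) * (if enorm y < 1 then dotrV y xi else 0)%:C))%R].

Definition continuous_negative_definite (psi : 'rV[R]_d -> R[i]) : Prop :=
  [/\ continuous (fun xi => complex.Re (psi xi)),
      continuous (fun xi => complex.Im (psi xi)) & levy_khintchine psi].

End negative_definite.

Section feller.
Context {R : realType} {d : nat} {dO : measure_display}
  {Omega : measurableType dO}.
Variables (P : 'rV[R]_d -> probability Omega R) (X : R -> Omega -> 'rV[R]_d).
(* The time parameter ranges over the nonnegative reals; X t is irrelevant for
   t < 0. *)

Definition natural_filtration (t : R) : set (set Omega) :=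
  <<s \bigcup_(s in `[0, t]) preimage_set_system setT (X s)
        (measurable : set (set (borelRV R d))) >>.

Definition stopping_time (tau : Omega -> \bar R) : Prop :=
  (forall w, (0 <= tau w)%E) /\
  forall t, 0 <= t -> natural_filtration t [set w | (tau w <= t%:E)%E].

(* the sigma-algebra of events prior to tau *)
Definition prior_events (tau : Omega -> \bar R) (A : set Omega) : Prop :=
  measurable A /\
  forall t, 0 <= t -> natural_filtration t (A `&` [set w | (tau w <= t%:E)%E]).

Definition strong_markov : Prop :=
  forall (x : 'rV[R]_d) (tau : Omega -> \bar R) (A : set Omega) (t : R)
    (B : set (borelRV R d)),
  stopping_time tau -> prior_events tau A -> 0 <= t -> measurable B ->
  P x (A `&` [set w | (tau w < +oo)%E /\ B (X (fine (tau w) + t) w)]) =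
  (\int[P x]_(w in A `&` [set w | tau w < +oo])
     P (X (fine (tau w)) w) (X t @^-1` B))%E.

Definition cadlag (f : R -> 'rV[R]_d) : Prop :=
  (forall t, 0 <= t -> f s @[s --> t^'+] --> f t) /\
  (forall t, 0 < t -> cvg (f s @[s --> t^'-])).

Definition feller_op (t : R) (u : 'rV[R]_d -> R) (x : 'rV[R]_d) : R :=
  \int[P x]_w u (X t w).
Local Notation T_ := feller_op.

Record feller_process : Prop := {
  fp_measurable : forall t, 0 <= t ->
    measurable_fun setT (X t : Omega -> borelRV R d) ;
  fp_start : forall x, P x [set w | X 0 w = x] = 1%E ;
  fp_cadlag : forall w, cadlag (X ^~ w) ;
  fp_kernel : forall t (B : set (borelRV R d)), 0 <= t -> measurable B ->
    measurable_fun setT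
      ((fun x => P x (X t @^-1` B)) : borelRV R d -> \bar R) ;
  fp_strong_markov : strong_markov ;
  fp_Cinfty : forall t u, 0 <= t -> Cinfty u -> Cinfty (T_ t u) ;
  fp_semigroup : forall s t u, 0 <= s -> 0 <= t -> Cinfty u ->
    T_ (s + t) u = T_ s (T_ t u) ;
  fp_id : forall u, Cinfty u -> T_ 0 u = u ;
  fp_sub_markov : forall t u, 0 <= t -> Cinfty u ->
    (forall x, 0 <= u x <= 1) -> forall x, 0 <= T_ t u x <= 1 ;
  fp_contraction : forall t u (M : R), 0 <= t -> Cinfty u ->
    (forall x, `|u x| <= M) -> forall x, `|T_ t u x| <= M ;
  fp_strongly_continuous : forall u, Cinfty u ->
    {uniform, (fun t => T_ t u) @ 0^'+ --> u}
}.

(* graph of the generator: u is in D(A) and A u = v *)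
Definition generator (u v : 'rV[R]_d -> R) : Prop :=
  [/\ Cinfty u, Cinfty v &
      {uniform, (fun t x => (T_ t u x - u x) / t) @ 0^'+ --> v}].

Definition generator_domain : set ('rV[R]_d -> R) :=
  [set u | exists v, generator u v].

Record is_symbol (q : 'rV[R]_d -> 'rV[R]_d -> R[i]) : Prop := {
  symbol_locally_bounded : forall r : R, exists M : R, forall x xi,
    enorm x <= r -> enorm xi <= r -> ComplexField.Normc.normc (q x xi) <= M ;
  symbol_measurable : forall xi,
    measurable_fun setT ((fun x => complex.Re (q x xi)) : borelRV R d -> R) /\
    measurable_fun setT ((fun x => complex.Im (q x xi)) : borelRV R d -> R) ;
  symbol_negative_definite : forall x, continuous_negative_definite (q x) ;
  symbol_generator : forall u v, Cc_smooth u -> generator u v -> forall x,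
    ((v x)%:C = - cintegral (lebesgue_rV d)
                    (fun xi => cis (dotrV x xi) * q x xi * fourier u xi))%C
}.

Record transition_density (p : R -> 'rV[R]_d -> 'rV[R]_d -> R) : Prop := {
  density_ge0 : forall t x y, 0 < t -> 0 <= p t x y ;
  density_measurable : forall t x, 0 < t ->
    measurable_fun setT (p t x : borelRV R d -> R) ;
  densityE : forall t x (B : set (borelRV R d)), 0 < t -> measurable B ->
    P x (X t @^-1` B) = (\int[lebesgue_rV d]_(y in B) (p t x y)%:E)%E
}.

End feller.

Section hausdorff.
Context {R : realType} {T : Type}.
Variable dist : T -> T -> R.
Local Open Scope ereal_scope.

(* 0 for the empty set *)
Definition diameter (A : set T) : \bar R :=
  ereal_sup (0 |` [set z | exists x y, [/\ A x, A y & z = (dist x y)%:E]]).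

(* diam(A)^s, with the conventions that it is 0 for empty A and that 0^0 = 1
   for nonempty A *)
Definition hausdorff_gauge (s : R) (A : set T) : \bar R :=
  if A == set0 then 0 else diameter A `^ s.

Definition hausdorff_premeasure (s delta : R) (A : set T) : \bar R :=
  ereal_inf [set \sum_(0 <= i <oo) hausdorff_gauge s (U i) |
    U in [set U : nat -> set T | A `<=` \bigcup_i U i /\
                                 forall i, diameter (U i) <= delta%:E]].

Definition hausdorff_measure (s : R) (A : set T) : \bar R :=
  ereal_sup [set hausdorff_premeasure s delta A | delta in [set e | (0 < e)%R]].

Definition hausdorff_dim (A : set T) : \bar R :=
  ereal_inf [set s%:E | s in [set s | (0 <= s)%R /\ hausdorff_measure s A = 0]].

End hausdorff.

Definition dimH_R {R : realType} : set R -> \bar R :=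
  hausdorff_dim (fun x y : R => `|x - y|).

Definition dimH_rV {R : realType} {d : nat} : set 'rV[R]_d -> \bar R :=
  hausdorff_dim (fun x y : 'rV[R]_d => enorm (x - y)).

(* analytic (Suslin) sets: the empty set and the continuous images of the Baire
   space *)
Definition analytic_set {R : realType} (E : set R) : Prop :=
  E = set0 \/
  exists f : prod_topology (fun _ : nat => nat) -> R,
    continuous f /\ range f = E.

(* Main.v *)
(* Fix s < dim E. A dyadic l^2 capacity of order s is positive on E, and it is
   continuous along increasing sequences of arbitrary sets, so the analytic set E
   contains a compact K of positive capacity (the Choquet capacitability
   argument). As the capacity is subadditive and at most 4 * 2^(-ns) on dyadic
   intervals of length 2^(-n), splitting mass proportionally to it down the dyadic
   tree yields a probability mu on K with mu(B(u, r)) <= C r^s (Frostman).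
   Lower alpha to min(alpha, d). Covering R^d by cubes of side r, the Markov
   property and the density bound give P(|X_u - X_v| <= r) <= C r^d |u-v|^(-d/alpha),
   hence, interpolating with the trivial bound 1,
   P(|X_u - X_v| <= r) <= C r^(alpha s') |u-v|^(-s') for s' < s. Integrating in v
   against mu shows that E mu{v : |X_u - X_v| <= 2^(-n)} is O(2^(-n alpha s'))
   uniformly in u, so by Fubini, for g < alpha s', almost surely the image of mu
   gives balls of radius 2^(-n) centred at X_u mass O(2^(-ng)) for all u in a
   non-null set, and the mass distribution principle gives dim X(E) >= g. *)
Require Import Defs.
From HB Require Import structures.
From mathcomp Require Import all_boot all_order all_algebra.
From mathcomp Require Import all_classical all_reals all_analysis.
From mathcomp Require Import measurable_realfun.
From mathcomp Require Import complex.
From mathcomp Require Import ring lra zify.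
Set Implicit Arguments.
Unset Strict Implicit.
Unset Printing Implicit Defensive.
Import Order.TTheory GRing.Theory Num.Theory.
Import numFieldNormedType.Exports.
Local Open Scope classical_set_scope.
Local Open Scope ring_scope.

(** * Dyadic capacities *)

(** The exponents form a strict chain [g / a < s2 < s1 < s0], where [E] has nonzero [s0]-dimensional
    Hausdorff measure. Each gap pays for one geometric series: [s1 < s0] for passing from Hausdorff
    measure to capacity, [s2 < s1] for summing over the distances |u - v|, and [g < a * s2] for
    summing over the radii 2^(-n). Lowering alpha to [a <= d] keeps the interpolation exponent a s /
    d at most 1, given s <= 1, which the Frostman step itself supplies. A pointwise bound for each
    radius would not suffice, since the mass distribution principle needs one constant for all
    radii. A weighted series over n, almost surely finite at mu-almost every time, provides it on a
    level set of positive mass. The image measure is never formed: the image need not be Borel and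
    the sets of a cover are arbitrary, so covers are pulled back to measurable sets of times. The
    measure mu and the exceptional null set both depend on g, which is why the conclusion passes
    through countably many rational g. *)

Section dyadic_sum.
Context {R : realType}.
Implicit Types (w f g : nat -> nat -> R) (N : nat).

Definition dyadic_sum N w f : R := \sum_(n < N) \sum_(k < 2 ^ n) w n k * f n k.

Lemma dyadic_sum0 w f : dyadic_sum 0 w f = 0.
Proof. by rewrite /dyadic_sum big_ord0. Qed.

Lemma dyadic_sumS N w f :
  dyadic_sum N.+1 w f = dyadic_sum N w f + \sum_(k < 2 ^ N) w N k * f N k.
Proof. by rewrite /dyadic_sum big_ord_recr. Qed.

Lemma dyadic_sumD N w f g :
  dyadic_sum N w (fun n k => f n k + g n k) =
  dyadic_sum N w f + dyadic_sum N w g.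
Proof.
rewrite /dyadic_sum -big_split; apply: eq_bigr => n _.
by rewrite -big_split; apply: eq_bigr => k _; rewrite mulrDr.
Qed.

Lemma dyadic_sumZ N w f a :
  dyadic_sum N w (fun n k => a * f n k) = a * dyadic_sum N w f.
Proof.
rewrite /dyadic_sum mulr_sumr; apply: eq_bigr => n _.
by rewrite mulr_sumr; apply: eq_bigr => k _; rewrite mulrCA.
Qed.

Lemma dyadic_sum_sum N w (F : nat -> nat -> nat -> R) J :
  dyadic_sum N w (fun n k => \sum_(j < J) F j n k) =
  \sum_(j < J) dyadic_sum N w (F j).
Proof.
elim: J => [|J IH].
  rewrite big_ord0 /dyadic_sum big1// => n _.
  by rewrite big1// => k _; rewrite big_ord0 mulr0.
rewrite big_ord_recr/= -IH -dyadic_sumD; apply: eq_bigr => n _.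
by apply: eq_bigr => k _; rewrite big_ord_recr.
Qed.

Lemma eq_dyadic_sum N w f g :
  (forall n k, (k < 2 ^ n)%N -> f n k = g n k) ->
  dyadic_sum N w f = dyadic_sum N w g.
Proof.
by move=> fg; apply: eq_bigr => n _; apply: eq_bigr => k _; rewrite fg.
Qed.

Lemma le_dyadic_sum N w f g : (forall n k, 0 <= w n k) ->
  (forall n k, (k < 2 ^ n)%N -> f n k <= g n k) ->
  dyadic_sum N w f <= dyadic_sum N w g.
Proof.
move=> w0 fg; apply: ler_sum => n _; apply: ler_sum => k _.
by rewrite ler_wpM2l// fg.
Qed.

Lemma dyadic_sum_homo N M w f : (forall n k, 0 <= w n k) ->
  (forall n k, (k < 2 ^ n)%N -> 0 <= f n k) ->
  (N <= M)%N -> dyadic_sum N w f <= dyadic_sum M w f.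
Proof.
move=> w0 f0 /subnK <-; elim: (M - N)%N => // i IH.
rewrite addSn dyadic_sumS (le_trans IH)// lerDl sumr_ge0// => k _.
by rewrite mulr_ge0// f0.
Qed.

Lemma dyadic_sum_ge0 N w f : (forall n k, 0 <= w n k) ->
  (forall n k, (k < 2 ^ n)%N -> 0 <= f n k) -> 0 <= dyadic_sum N w f.
Proof.
by move=> w0 f0; rewrite -(dyadic_sum0 w f); exact: dyadic_sum_homo.
Qed.

Lemma dyadic_sum_term N w f n k : (forall n k, 0 <= w n k) ->
  (forall n k, (k < 2 ^ n)%N -> 0 <= f n k) -> (n < N)%N -> (k < 2 ^ n)%N ->
  w n k * f n k <= dyadic_sum N w f.
Proof.
move=> w0 f0 nN kn; apply: le_trans (dyadic_sum_homo w0 f0 nN).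
rewrite dyadic_sumS (bigD1 (Ordinal kn))//= addrCA lerDl addr_ge0//.
  exact: dyadic_sum_ge0.
by apply: sumr_ge0 => i _; rewrite mulr_ge0// f0.
Qed.

Lemma cvg_dyadic_sum N w (F : nat -> nat -> nat -> R) f :
  (forall n k, (k < 2 ^ n)%N -> F ^~ n ^~ k @ \oo --> f n k) ->
  dyadic_sum N w (F j) @[j --> \oo] --> dyadic_sum N w f.
Proof.
move=> Ff; rewrite /dyadic_sum.
apply: (@cvg_big _ _ +%R) => [|n _]; first exact: add_continuous.
apply: (@cvg_big _ _ +%R) => [|k _]; first exact: add_continuous.
by apply: cvgM; [exact: cvg_cst|exact: Ff].
Qed.

End dyadic_sum.

(* An l^2 capacity: its convexity, through the parallelogram identity, makes it
   continuous along increasing sequences of arbitrary sets. *)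
Section capacity.
Context {R : realType} {T : Type}.
Variables (U : nat -> nat -> set T) (w : nat -> nat -> R).
Hypothesis w_gt0 : forall n k, 0 < w n k.
Implicit Types (f g : nat -> nat -> R) (A B : set T) (a b c : R).

Definition potential N f (x : T) : R := dyadic_sum N (fun n k => \1_(U n k) x) f.

Definition energy N f : R := dyadic_sum N w (fun n k => f n k ^+ 2).

(* The strict inequality makes admissibility an open condition on [x]. *)
Definition admissible f A :=
  (forall n k, 0 <= f n k) /\ forall x, A x -> exists N, 1 < potential N f x.

(** Bounding all partial energies keeps the capacity real-valued and finitary: no infinite sum
    appears, and the infimum over [c] is taken only when numerical values are needed, in
    [frostman_compact]. *)
Definition capacity_le A c :=
  exists2 f, admissible f A & forall N, energy N f <= c.

Let w_ge0 n k : 0 <= w n k. Proof. exact: ltW. Qed.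

Let indic_ge0 x n k : 0 <= \1_(U n k) x :> R.
Proof. by rewrite indicE. Qed.

Lemma energy_homo N M f : (N <= M)%N -> energy N f <= energy M f.
Proof. by apply: dyadic_sum_homo => // n k _; exact: sqr_ge0. Qed.

Lemma energy_ge0 N f : 0 <= energy N f.
Proof. by apply: dyadic_sum_ge0 => // n k _; exact: sqr_ge0. Qed.

Lemma capacity_le_ge0 A c : capacity_le A c -> 0 <= c.
Proof. by move=> [f _ /(_ 0%N)]; apply: le_trans; exact: energy_ge0. Qed.

Lemma capacity_leS A B a b : A `<=` B -> a <= b ->
  capacity_le B a -> capacity_le A b.
Proof.
move=> AB ab [f [f0 fB] fa]; exists f; last by move=> N; exact: le_trans ab.
by split=> // x /AB; exact: fB.
Qed.

Lemma admissibleS f g A : (forall n k, 0 <= g n k) ->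
  (forall n k, (k < 2 ^ n)%N -> f n k <= g n k) ->
  admissible f A -> admissible g A.
Proof.
move=> g0 fg [f0 fA]; split=> // x /fA[N fN]; exists N.
by apply: lt_le_trans fN _; exact: le_dyadic_sum.
Qed.

Lemma capacity_le_set0 c : 0 <= c -> capacity_le set0 c.
Proof.
move=> c0; exists (fun _ _ => 0); first by split.
move=> N; rewrite /energy /dyadic_sum big1// => n _.
by rewrite big1// => k _; rewrite expr0n mulr0.
Qed.

(** The function sqrt(f^2 + g^2) dominates both test functions, and its energy is exactly the sum of
    theirs. *)
Lemma capacity_leU A B a b :
  capacity_le A a -> capacity_le B b -> capacity_le (A `|` B) (a + b).
Proof.
move=> [f fA fa] [g gB gb].
pose h n k := Num.sqrt (f n k ^+ 2 + g n k ^+ 2).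
have h0 n k : 0 <= h n k by exact: sqrtr_ge0.
have fh : admissible h A.
  apply: (admissibleS h0 _ fA) => n k _; rewrite -[leLHS]ger0_norm ?fA.1//.
  by rewrite -sqrtr_sqr ler_sqrt ?lerDl ?addr_ge0 ?sqr_ge0.
have gh : admissible h B.
  apply: (admissibleS h0 _ gB) => n k _; rewrite -[leLHS]ger0_norm ?gB.1//.
  by rewrite -sqrtr_sqr ler_sqrt ?lerDr ?addr_ge0 ?sqr_ge0.
exists h; first by split=> // x [/fh.2|/gh.2].
move=> N; rewrite /energy.
under eq_dyadic_sum => n k _ do rewrite sqr_sqrtr ?addr_ge0 ?sqr_ge0//.
by rewrite dyadic_sumD lerD ?fa ?gb.
Qed.

(** The midpoint of two admissible functions is admissible, so its energy exceeds [c] from some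
    level on. The parallelogram identity then leaves little energy for the difference: two nearly
    optimal functions are close. *)
Lemma energy_sub_le A f g a b c : admissible f A -> admissible g A ->
  (forall N, energy N f <= a) -> (forall N, energy N g <= b) ->
  ~ capacity_le A c ->
  forall N, energy N (fun n k => f n k - g n k) <= 2 * (a + b) - 4 * c.
Proof.
move=> fA gA fa gb Ac N.
pose h n k := 2^-1 * (f n k + g n k).
have hA : admissible h A.
  split=> [n k|x Ax]; first by rewrite mulr_ge0// addr_ge0 ?fA.1 ?gA.1.
  have [N1 fN1] := fA.2 x Ax; have [N2 gN2] := gA.2 x Ax.
  exists (maxn N1 N2); rewrite /potential dyadic_sumZ dyadic_sumD.
  have : 1 < potential (maxn N1 N2) f x.
    apply: lt_le_trans fN1 _; apply: dyadic_sum_homo => //; last exact: leq_maxl.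
    by move=> n k _; exact: fA.1.
  have : 1 < potential (maxn N1 N2) g x.
    apply: lt_le_trans gN2 _; apply: dyadic_sum_homo => //; last exact: leq_maxr.
    by move=> n k _; exact: gA.1.
  by rewrite /potential; lra.
have [M cM] : exists M, c < energy M h.
  apply: contrapT => /forallNP H; apply: Ac; exists h => // M.
  by rewrite leNgt; apply/negP/H.
pose K := maxn N M.
have cK : c < energy K h by apply: lt_le_trans cM (energy_homo _ (leq_maxr _ _)).
apply: le_trans (energy_homo _ (leq_maxl N M)) _; rewrite -/K.
have E : energy K (fun n k => f n k - g n k) + 4 * energy K h =
    2 * energy K f + 2 * energy K g.
  rewrite /energy -!dyadic_sumZ -!dyadic_sumD; apply: eq_dyadic_sum => n k _.
  by rewrite /h; field.
by have := fa K; have := gb K; lra.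
Qed.

(** Nearly optimal functions [f j] for an increasing subsequence are Cauchy in energy. Their limit
    could lose the strict inequality at some points, so a common majorant of all [f j] is used
    instead; fast convergence makes its energy exceed the limit capacity [m] by little. *)
Lemma capacity_le_bigcup (A : nat -> set T) c c' :
  (forall n m, (n <= m)%N -> A n `<=` A m) ->
  (forall n, capacity_le (A n) c) -> c < c' -> capacity_le (\bigcup_n A n) c'.
Proof.
move=> ndA Ac cc'.
pose S := [set c | forall n, capacity_le (A n) c].
pose m := inf S.
have lbS : lbound S 0 by move=> r /(_ 0%N) /capacity_le_ge0.
have infS : has_inf S by split; [exists c|exists 0].
have m0 : 0 <= m by apply: lb_le_inf => //; exists c.
have mc : m <= c by apply: ge_inf => //; exists 0.
have mle e n : 0 < e -> capacity_le (A n) (m + e).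
  move=> e0; have [r rS rm] := inf_adherent e0 infS.
  by apply: capacity_leS (rS n) => //; exact: ltW.
have mgt e : exists n, 0 < e -> ~ capacity_le (A n) (m - e).
  apply: contrapT => /forallNP H.
  have e0 : 0 < e by apply: contrapT => e0; apply: (H 0%N) => /e0.
  have : m <= m - e.
    apply: ge_inf; first by exists 0.
    by move=> n; apply: contrapT => An; apply: (H n).
  lra.
(* The majorant will have energy at most m + eta + eta (9 + m), so 10 + m would do in the
   denominator; 20 leaves slack. *)
pose eta : R := Num.min 1 ((c' - m) / (20 + m)).
have eta0 : 0 < eta by rewrite lt_min ltr01 divr_gt0//; lra.
have eta1 : eta <= 1 by rewrite ge_min lexx.
have etac : eta * (20 + m) <= c' - m.
  by rewrite -ler_pdivlMr ?ge_min ?lexx ?orbT//; lra.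
pose et j : R := eta * 2^-1 ^+ j.+1.
have et0 j : 0 < et j by rewrite mulr_gt0// exprn_gt0.
have et1 j : et j <= 1.
  by rewrite -(mulr1 1) ler_pM ?(ltW eta0)// ?exprn_ge0// exprn_ile1//; lra.
have etS j : et j.+1 <= et j.
  by rewrite ler_pM2l// ler_wiXn2l//; lra.
have sum_et J : \sum_(j < J) et j <= eta.
  suff -> : \sum_(j < J) et j = eta * (1 - 2^-1 ^+ J).
    by rewrite ler_piMr ?(ltW eta0)// lerBlDr lerDl exprn_ge0.
  elim: J => [|J IH]; first by rewrite big_ord0 expr0 subrr mulr0.
  by rewrite big_ord_recr/= IH /et exprS; field.
have [N0 N0P] := choice (fun j => mgt (et j ^+ 2)).
(* Partial sums give a nondecreasing sequence of indices above both [N0 j] and [j]. The bound by [j]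
   ensures that each [A i] lies in [A (nn i)]. *)
pose nn j := (\sum_(i < j.+1) (N0 i + i))%N.
have nnS j : (nn j <= nn j.+1)%N by rewrite /nn [leqRHS]big_ord_recr/= leq_addr.
have nnge j : (N0 j <= nn j)%N /\ (j <= nn j)%N.
  by rewrite /nn big_ord_recr/=; split; lia.
have /choice[f fP] j : exists f, admissible f (A (nn j)) /\
    forall N, energy N f <= m + et j ^+ 2.
  by have [f fA fe] := mle (et j ^+ 2) (nn j) (exprn_gt0 _ (et0 j)); exists f.
(* Telescoping the squares, rather than the functions, yields a majorant [H] of every square
   [f J ^+ 2] whose energy is estimated term by term. *)
pose D j n k := `|f j.+1 n k ^+ 2 - f j n k ^+ 2|.
pose H J n k := f 0%N n k ^+ 2 + \sum_(j < J) D j n k.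
have D0 j n k : 0 <= D j n k by exact: normr_ge0.
have HS J n k : H J.+1 n k = H J n k + D J n k by rewrite /H big_ord_recr addrA.
have ndH n k : nondecreasing_seq (fun J => H J n k).
  by apply/nondecreasing_seqP => J; rewrite HS lerDl.
have fH J n k : f J n k ^+ 2 <= H J n k.
  elim: J => [|J IH]; first by rewrite /H big_ord0 addr0.
  rewrite HS; have := ler_norm (f J.+1 n k ^+ 2 - f J n k ^+ 2).
  by rewrite -/(D J n k); lra.
have H0 J n k : 0 <= H J n k by rewrite (le_trans _ (fH J n k))// sqr_ge0.
have eD j N : dyadic_sum N w (D j) <= et j * (9 + m).
  (* Both functions have energy at most m + et^2, while m - et^2 is not reached: 2 (2 m + 2 et^2) -
     4 (m - et^2) = 8 et^2. *)
  have ed : energy N (fun n k => f j n k - f j.+1 n k) <= 8 * et j ^+ 2.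
    have : ~ capacity_le (A (nn j)) (m - et j ^+ 2).
      move=> H'; apply: (N0P j); first by rewrite exprn_gt0.
      by apply: capacity_leS H' => //; apply: ndA; exact: (nnge j).1.
    have fS : admissible (f j.+1) (A (nn j)).
      by split=> [n k|x /(ndA _ _ (nnS j))]; [exact: (fP _).1.1|exact: (fP _).1.2].
    move=> /(energy_sub_le (fP j).1 fS (fP j).2 (fP j.+1).2)/(_ N)/le_trans; apply.
    have : et j.+1 ^+ 2 <= et j ^+ 2 by rewrite ler_sqr ?nnegrE ?(ltW (et0 _)).
    lra.
  (* Young's inequality for |x - y| |x + y| with parameter [et j] balances the two terms: the first
     contributes 8 et, the second at most (m + 1) et. *)
  have : dyadic_sum N w (D j) <=
      (et j)^-1 * energy N (fun n k => f j n k - f j.+1 n k) +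
      (et j / 2) * (energy N (f j) + energy N (f j.+1)).
    rewrite /energy -dyadic_sumD -!dyadic_sumZ -dyadic_sumD.
    apply: le_dyadic_sum => // n k _; rewrite /D.
    set x := f j n k; set y := f j.+1 n k.
    set t := et j; have t0 : 0 < t := et0 j.
    rewrite subr_sqr normrM distrC.
    have -> : (x - y) ^+ 2 = `|x - y| ^+ 2 by rewrite real_normK// num_real.
    have h1 : `|y + x| ^+ 2 <= 2 * (x ^+ 2 + y ^+ 2).
      rewrite real_normK ?num_real//; have := sqr_ge0 (x - y).
      by rewrite !expr2; lra.
    apply: le_trans (_ : t^-1 * `|x - y| ^+ 2 + t / 4 * `|y + x| ^+ 2 <= _).
      set p := `|x - y|; set q := `|y + x|.
      have -> : t^-1 * p ^+ 2 + t / 4 * q ^+ 2 = p * q + t^-1 * (p - t / 2 * q) ^+ 2.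
        by field; lra.
      by rewrite lerDl mulr_ge0// ?sqr_ge0// invr_ge0 ltW.
    rewrite lerD2l (_ : t / 2 * _ = t / 4 * (2 * (x ^+ 2 + y ^+ 2))); last by field.
    by rewrite ler_pM2l//; lra.
  move=> /le_trans; apply.
  rewrite (_ : et j * (9 + m) = (et j)^-1 * (8 * et j ^+ 2) +
     et j / 2 * ((m + 1) + (m + 1))); last by field; rewrite gt_eqF.
  have et2 i : et i ^+ 2 <= 1 by rewrite exprn_ile1// ltW.
  rewrite lerD// ler_pM2l ?invr_gt0 ?divr_gt0//.
  rewrite lerD// (le_trans ((fP _).2 _))// lerD2l//.
have eH J N : dyadic_sum N w (H J) <= c'.
  rewrite /H dyadic_sumD dyadic_sum_sum.
  apply: le_trans (_ : (m + eta) + eta * (9 + m) <= _).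
    apply: lerD; first apply: le_trans ((fP 0%N).2 N) _.
      rewrite lerD2l; apply: le_trans (_ : et 0%N <= _).
        by rewrite expr2 ler_piMr ?(ltW (et0 _)).
      by rewrite /et ler_piMr ?(ltW eta0)// exprn_ile1//; lra.
    apply: le_trans (_ : \sum_(j < J) et j * (9 + m) <= _).
      by apply: ler_sum => j _; exact: eD.
    by rewrite -mulr_suml ler_wpM2r//; lra.
  lra.
have ubH n k : (k < 2 ^ n)%N -> has_ubound (range (fun J => H J n k)).
  move=> kn; exists (c' / w n k) => _ [J _ <-].
  rewrite ler_pdivlMr// mulrC; apply: le_trans (eH J n.+1).
  exact: dyadic_sum_term.
pose h n k := sup (range (fun J => H J n k)).
have cvgH n k : (k < 2 ^ n)%N -> H J n k @[J --> \oo] --> h n k.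
  by move=> kn; apply: nondecreasing_cvgn => //; exact: ubH.
have Hh J n k : (k < 2 ^ n)%N -> H J n k <= h n k.
  by move=> kn; apply: ub_le_sup; [exact: ubH|exists J].
exists (fun n k => Num.sqrt (h n k)).
  split=> [n k|x [i _ Aix]]; first exact: sqrtr_ge0.
  have [N fN] := (fP i).1.2 x (ndA _ _ (nnge i).2 _ Aix).
  exists N; apply: lt_le_trans fN _; apply: le_dyadic_sum => // n k kn.
  rewrite -[leLHS]ger0_norm ?(fP i).1.1// -sqrtr_sqr ler_wsqrtr//.
  by rewrite (le_trans (fH i n k))// Hh.
move=> N; rewrite /energy.
rewrite (@eq_dyadic_sum _ _ _ _ h); last first.
  by move=> n k kn; rewrite sqr_sqrtr// (le_trans (H0 0%N n k))// Hh.
have cv := cvg_dyadic_sum (w := w) (N := N) cvgH.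
rewrite -(cvg_lim _ cv)//; apply: limr_le; first by apply/cvg_ex; eexists; exact: cv.
by apply: nearW => J; exact: eH.
Qed.

End capacity.

(** * Capacitability of analytic sets *)

Section analytic.

(** If no cylinder around [p] lies in [A], points outside [A] that agree with [p] on longer and
    longer prefixes converge to [p] in the product topology. *)
Lemma nbhs_baireP (p : prod_topology (fun _ : nat => nat))
    (A : set (prod_topology (fun _ : nat => nat))) :
  nbhs p A <-> exists k, forall z, (forall j, (j < k)%N -> z j = p j) -> A z.
Proof.
split=> [pA|[k kA]].
  apply: contrapT => /forallNP H.
  have /choice[z zP] k : exists z : prod_topology (fun _ : nat => nat),
      (forall j, (j < k)%N -> z j = p j) /\ ~ A z.
    have /existsNP[z /not_implyP[zp Az]] := H k.
    by exists z.
  have zp : z @ \oo --> p.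
    apply/cvg_sup => N V [W [[W' oW' <-] /= W'p W'V]].
    apply: (filterS W'V); exists N.+1 => // i /= Ni.
    by rewrite (zP i).1.
  have /zp [n _ /(_ n)] := pA; rewrite /= leqnn => /(_ isT).
  exact: (zP n).2.
have : \forall z \near p, forall j, (j < k)%N -> z j = p j.
  elim: k {kA} => [|k IH]; first by apply: (@nearW _ (nbhs p)).
  have pk : \forall z \near p, z k = p k.
    have pk : nbhs (p k) [set n | n = p k] by rewrite nbhs_principalE; exact/principal_filterP.
    exact: (@proj_continuous nat (fun=> nat) k p _ pk).
  apply: filterS2 pk IH => z zk IH j; rewrite ltnS leq_eqVlt.
  by move=> /predU1P[->//|]; exact: IH.
by apply: filterS.
Qed.

Context {R : realType} {T : topologicalType}.
Variables (U : nat -> nat -> set T) (w : nat -> nat -> R).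
Hypothesis w_gt0 : forall n k, 0 < w n k.
Hypothesis openU : forall n k, open (U n k).

(** A truncated potential involves finitely many open sets with nonnegative coefficients, so it
    cannot drop near [x]. Hence a function admissible for a compact set is admissible for a
    neighbourhood of it. *)
Lemma open_potential_gt1 (g : nat -> nat -> R) : (forall n k, 0 <= g n k) ->
  open [set x | exists N, 1 < potential U N g x].
Proof.
move=> g0; rewrite openE => x [N Nx].
have : \forall y \near x, forall n, (n < N)%N -> forall k, (k < 2 ^ n)%N ->
    U n k x -> U n k y.
  elim: N {Nx} => [|N IH]; first by apply: nearW.
  have : \forall y \near x, forall k, (k < 2 ^ N)%N -> U N k x -> U N k y.
    elim: (2 ^ N)%N => [|K IHK]; first by apply: nearW.
    have : \forall y \near x, U N K x -> U N K y.
      have [xU|xU] := pselect (U N K x); last by apply: nearW.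
      have : nbhs x (U N K) by apply: open_nbhs_nbhs; split.
      by apply: filterS.
    move=> H; apply: filterS2 H IHK => y yK IHK k; rewrite ltnS leq_eqVlt.
    by move=> /predU1P[->//|]; exact: IHK.
  move=> H; apply: filterS2 H IH => y yN IH n; rewrite ltnS leq_eqVlt.
  by move=> /predU1P[->//|]; exact: IH.
apply: filterS => y xy; exists N; apply: lt_le_trans Nx _.
apply: ler_sum => n _; apply: ler_sum => k _.
rewrite ler_wpM2r// !indicE ler_nat.
have [/set_mem xU|] //= := boolP (x \in U n k).
by rewrite (mem_set (xy _ (ltn_ord n) _ (ltn_ord k) xU)).
Qed.

(** The coordinates of the Baire space are bounded one at a time. Each bound exhausts the previous
    set by an increasing union, so it can be chosen with an arbitrarily small loss of capacity; the
    resulting product of finite sets is compact. *)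
Lemma capacity_le_analytic (f : prod_topology (fun _ : nat => nat) -> T) c c' :
  continuous f -> c' < c -> ~ capacity_le U w (range f) c ->
  exists K, [/\ compact K, K `<=` range f & ~ capacity_le U w K c'].
Proof.
move=> cf c'c fc.
pose C (s : seq nat) : set (prod_topology (fun _ : nat => nat)) :=
  [set x | forall j, (j < size s)%N -> (x j <= nth 0%N s j)%N].
(* A strictly decreasing budget from c towards c', since continuity along increasing unions costs a
   strict inequality at every step. *)
pose cc k : R := c' + (c - c') * 2^-1 ^+ k.
have step s : exists n, ~ capacity_le U w (f @` C s) (cc (size s)) ->
    ~ capacity_le U w (f @` C (rcons s n)) (cc (size s).+1).
  apply: contrapT => /forallNP H.
  have sc : ~ capacity_le U w (f @` C s) (cc (size s)).
    by apply: contrapT => sc; apply: (H 0%N) => /sc.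
  apply: sc.
  have -> : f @` C s = \bigcup_n (f @` C (rcons s n)).
    apply/seteqP; split=> [_ [x xC <-]|_ [n _ [x xC <-]]].
      exists (x (size s)) => //; exists x => // j.
      rewrite size_rcons ltnS leq_eqVlt nth_rcons.
      by move=> /predU1P[->|js]; rewrite ?ltnn ?eqxx// js xC.
    exists x => // j js; have := xC j; rewrite size_rcons nth_rcons js.
    by apply; rewrite ltnW.
  apply: (@capacity_le_bigcup _ _ _ _ w_gt0 _ (cc (size s).+1)).
  - move=> n m nm _ [x xC <-]; exists x => // j; rewrite size_rcons => js.
    apply: leq_trans (xC j _) _; first by rewrite size_rcons.
    by rewrite !nth_rcons; case: ifP => // _; case: ifP.
  - by move=> n; apply: contrapT => Hn; apply: (H n).
  - rewrite ltrD2l ltr_pM2l ?subr_gt0// exprS gtr_pMl ?exprn_gt0//.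
    lra.
have [g gP] := choice step.
pose fix S k := if k is k'.+1 then rcons (S k') (g (S k')) else [::].
have sizeS k : size (S k) = k by elim: k => //= k IH; rewrite size_rcons IH.
have SP k : ~ capacity_le U w (f @` C (S k)) (cc k).
  elim: k => [|k IH] /=.
    rewrite (_ : f @` C [::] = range f); last by congr image; apply/seteqP; split.
    by rewrite /cc expr0 mulr1 addrC subrK.
  by rewrite -[in cc _](sizeS k); apply: gP; rewrite sizeS.
pose b k := g (S k).
have nthS k j : (j < k)%N -> nth 0%N (S k) j = b j.
  elim: k => // k IH; rewrite ltnS leq_eqVlt /= nth_rcons sizeS.
  by move=> /predU1P[->|jk]; rewrite ?ltnn ?eqxx// jk IH.
pose Cb : set (prod_topology (fun _ : nat => nat)) :=
  [set x | forall j, [set n | (n <= b j)%N] (x j)].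
have compactCb : compact Cb.
  apply: (@tychonoff nat (fun=> nat) (fun j => [set n | (n <= b j)%N])) => j.
  by apply: finite_compact; exact: (finite_II (b j).+1).
exists (f @` Cb); split.
- apply: continuous_compact => //; exact: continuous_subspaceT.
- by move=> _ [x _ <-]; exists x.
move=> [h hK hc].
pose O := f @^-1` [set x | exists N, 1 < potential U N h x].
have oO : open O.
  by apply: open_comp => [x _|]; [exact: cf|exact: open_potential_gt1 hK.1].
have /choice[x xP] k : exists x, C (S k) x /\ ~ O x.
  apply: contrapT => H; apply: (SP k).
  exists h; last first.
    move=> N; apply: le_trans (hc N) _; rewrite lerDl mulr_ge0 ?exprn_ge0//.
    by rewrite subr_ge0 ltW.
  split=> [|_ [x xC <-]]; first exact: hK.1.
  by apply: contrapT => Ox; apply: H; exists x.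
(* Truncation moves [x k] into the compact set without changing its first k coordinates. Near a
   cluster point of [y] these coordinates alone decide membership in [O], which [x k] was chosen to
   avoid. *)
pose y k : prod_topology (fun _ : nat => nat) := fun j => minn (x k j) (b j).
have [] := compactCb (y @ \oo).
  by exists 0%N => // k _ j; exact: geq_minr.
move=> p [pC py].
have /nbhs_baireP[k kO] : nbhs p O.
  by apply: open_nbhs_nbhs; split => //; apply: hK.2; exists p.
have [] := py [set z | exists2 i, (k <= i)%N & z = y i]
  [set z | forall j, (j < k)%N -> z j = p j].
- by exists k => // i /= ki; exists i.
- by apply/nbhs_baireP; exists k.
move=> _ [[i ki ->] yp]; apply: (xP i).2; apply: kO => j jk.
rewrite -yp//; have := (xP i).1 j; rewrite sizeS nthS ?(leq_trans jk)//.
by rewrite /y => /(_ isT)/minn_idPl ->.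
Qed.

End analytic.

(** * Capacity and Hausdorff measure *)

Section hausdorff_measure_facts.
Context {R : realType}.

Lemma nneseries_le (u : nat -> \bar R) (x : \bar R) :
  (forall i, 0 <= u i)%E -> (forall N, \sum_(0 <= i < N) u i <= x)%E ->
  (\sum_(0 <= i <oo) u i <= x)%E.
Proof.
move=> u0 ux; apply: lime_le; last by apply: nearW.
by apply: is_cvg_nneseries => n _ _.
Qed.

Context {T : Type}.
Variable dist : T -> T -> R.

Lemma diameter_ge0 (A : set T) : (0 <= diameter dist A)%E.
Proof. by apply: ereal_sup_ubound; left. Qed.

Lemma le_diameter (A : set T) x y : A x -> A y ->
  ((dist x y)%:E <= diameter dist A)%E.
Proof. by move=> Ax Ay; apply: ereal_sup_ubound; right; exists x, y. Qed.

Lemma diameter_le (A : set T) (r : R) : 0 <= r ->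
  (forall x y, A x -> A y -> dist x y <= r) -> (diameter dist A <= r%:E)%E.
Proof.
move=> r0 Ar; apply: ge_ereal_sup => _ [->|[x [y [Ax Ay ->]]]].
  by rewrite lee_fin.
by rewrite lee_fin Ar.
Qed.

Lemma hausdorff_gauge_ge0 s (A : set T) : (0 <= hausdorff_gauge dist s A)%E.
Proof. by rewrite /hausdorff_gauge; case: ifP => // _; exact: poweR_ge0. Qed.

Lemma hausdorff_measure_eq0P s (A : set T) :
  hausdorff_measure dist s A = 0%E <->
  forall e d : R, 0 < e -> 0 < d -> exists U : nat -> set T,
    [/\ A `<=` \bigcup_i U i, forall i, (diameter dist (U i) <= d%:E)%E &
      (\sum_(0 <= i <oo) hausdorff_gauge dist s (U i) <= e%:E)%E].
Proof.
have premeasure_ge0 d : (0 <= hausdorff_premeasure dist s d A)%E.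
  apply: le_ereal_inf_tmp => _ [U _ <-].
  by apply: nneseries_ge0 => i _ _; exact: hausdorff_gauge_ge0.
split=> [A0 e d e0 d0|H].
  have : (hausdorff_premeasure dist s d A < e%:E)%E.
    apply: (@le_lt_trans _ _ 0%E); last by rewrite lte_fin.
    by rewrite -A0; apply: ereal_sup_ubound; exists d.
  move=> /ereal_inf_lt[_ [U [AU Ud] <-] Ue].
  by exists U; split => //; exact: ltW.
apply/eqP; rewrite eq_le; apply/andP; split; last first.
  apply: le_trans (premeasure_ge0 1) _.
  by apply: ereal_sup_ubound; exists 1 => //=.
apply: ge_ereal_sup => _ [d d0 <-].
apply/lee_addgt0Pr => e e0; rewrite add0e.
have [U [AU Ud Ue]] := H e d e0 d0.
by apply: le_trans Ue; apply: ereal_inf_lbound; exists U.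
Qed.

End hausdorff_measure_facts.

Lemma powR2N_lt1 {R : realType} (x : R) : 0 < x -> 2 `^ (- x) < 1.
Proof.
move=> x0; rewrite powRN invf_lt1 ?powR_gt0//.
apply: (@le_lt_trans _ _ (1 `^ x)); first by rewrite powR1.
by apply: gt0_ltr_powR => //; rewrite ?nnegrE ?ltr1n.
Qed.

Lemma half_powR {R : realType} (x : R) n : (2^-1 ^+ n : R) `^ x = (2 `^ (- x)) ^+ n.
Proof.
rewrite -[RHS]powR_mulrn ?powR_ge0// -powRrM -powR_mulrn ?invr_ge0//.
rewrite -[in LHS]powR_inv1// -!powRrM.
by congr (_ `^ _); ring.
Qed.

Lemma dyadic_scale {R : realType} (d : R) : 0 < d <= 1 ->
  exists n, 2^-1 ^+ n.+1 <= d <= 2^-1 ^+ n.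
Proof.
move=> /andP[d0 d1].
have exj : exists j, 2^-1 ^+ j.+1 <= d.
  have /cvgrPdist_le/(_ _ d0)[n0 _ /(_ n0 (leqnn n0))] :
      2^-1 ^+ n @[n --> \oo] --> (0 : R) by apply: cvg_expr; rewrite ger0_norm; lra.
  rewrite /= sub0r normrN ger0_norm ?exprn_ge0// => h; exists n0.
  by apply: le_trans h; apply: ler_wiXn2l => //; lra.
case: (ex_minnP exj) => j jP jmin; exists j; rewrite jP/=.
case: j jP jmin => [|j] jP jmin; first by rewrite expr0.
by rewrite leNgt; apply/negP => /ltW/jmin; rewrite ltnn.
Qed.

Section dyadic_capacity.
Context {R : realType}.

(* Open, and large enough to contain the closed dyadic interval [k/2^n, (k+1)/2^n]. *)
Definition dyadic_nbhd (n k : nat) : set R :=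
  `](k%:R - 1) / 2 ^+ n, (k%:R + 2) / 2 ^+ n[.

Definition dyadic_capacity_le (b : R) (A : set R) (c : R) :=
  capacity_le dyadic_nbhd (fun n _ => b ^+ n) A c.

Lemma dyadic_nbhdE n k (x : R) :
  dyadic_nbhd n k x <-> k%:R - 1 < x * 2 ^+ n < k%:R + 2.
Proof. by rewrite /dyadic_nbhd /= in_itv/= ltr_pdivrMr// ltr_pdivlMr. Qed.

Lemma sum_indic_eq (M t : nat) (h : nat -> nat) : injective h ->
  \sum_(k < M) (h k == t)%:R <= 1 :> R.
Proof.
move=> inj; rewrite -natr_sum lern1; elim: M => [|M IH]; first by rewrite big_ord0.
rewrite big_ord_recr/=; have [hM|] := eqVneq (h M) t; last by rewrite addn0.
rewrite big1 => // i _; apply/eqP; rewrite eqb0 -hM; apply: contraTN (ltn_ord i).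
by move/eqP/inj => ->; rewrite ltnn.
Qed.

(** Membership means k - 1 < 2^n x < k + 2, which leaves only the indices t - 2, t - 1 and t. *)
Lemma dyadic_nbhd_overlap n M (x : R) :
  \sum_(k < M) \1_(dyadic_nbhd n k) x <= 3 :> R.
Proof.
pose t := Num.truncn (x * 2 ^+ n + 1).
apply: le_trans (_ : \sum_(k < M) ((k == t :> nat)%:R + (k.+1 == t)%:R +
   (k.+2 == t)%:R) <= _).
  apply: ler_sum => k _; rewrite indicE.
  have [/set_mem/dyadic_nbhdE/andP[kx xk]|_] //= := boolP (x \in _); last first.
    by rewrite !addr_ge0.
  have kt : (k <= t)%N by rewrite /t truncn_ge_nat; have := ler0n R k; lra.
  have tk : (t <= k.+2)%N.
    by rewrite /t truncn_le_nat -addn3 natrD; lra.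
  rewrite -!natrD ler_nat; lia.
rewrite !big_split/=.
have h1 := @sum_indic_eq M t id (fun x y => id).
have h2 := @sum_indic_eq M t succn succn_inj.
have h3 := @sum_indic_eq M t (succn \o succn) (inj_comp succn_inj succn_inj).
by rewrite /= in h1 h2 h3; lra.
Qed.

(* Dyadic intervals are enumerated as the nodes of a binary heap. *)
Definition heap_level i := trunc_log 2 i.+1.
Definition heap_pos i := (i.+1 - 2 ^ heap_level i)%N.

Lemma heapK n k : (k < 2 ^ n)%N ->
  heap_level (2 ^ n + k - 1) = n /\ heap_pos (2 ^ n + k - 1) = k.
Proof.
move=> kn; have n0 : (0 < 2 ^ n)%N by rewrite expn_gt0.
have e : (2 ^ n + k - 1).+1 = (2 ^ n + k)%N by lia.
have l : heap_level (2 ^ n + k - 1) = n.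
  by rewrite /heap_level e; apply: trunc_log_eq => //; rewrite expnS; lia.
by rewrite /heap_pos l e addKn.
Qed.

Lemma heap_pos_lt i : (heap_pos i < 2 ^ heap_level i)%N.
Proof.
rewrite /heap_pos; have /andP[] := @trunc_log_bounds 2 i.+1 isT isT.
by rewrite -/(heap_level i) expnS; lia.
Qed.

Lemma sum_heap (G : nat -> nat -> R) N :
  \sum_(0 <= i < 2 ^ N - 1)
    G (heap_level i) (heap_pos i) =
  \sum_(n < N) \sum_(k < 2 ^ n) G n k.
Proof.
elim: N => [|N IH]; first by rewrite big_ord0 big_geq.
have N0 : (0 < 2 ^ N)%N by rewrite expn_gt0.
rewrite big_ord_recr/= -IH (@big_cat_nat _ _ _ (2 ^ N - 1))//=; last first.
  by rewrite leq_sub2r// leq_pexp2l.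
congr (_ + _); rewrite -{1}[(2 ^ N - 1)%N]add0n big_addn big_mkord.
have -> : (2 ^ N.+1 - 1 - (2 ^ N - 1) = 2 ^ N)%N by rewrite expnS; lia.
apply: eq_bigr => k _.
have [+ +] := heapK (ltn_ord k).
by rewrite (_ : 2 ^ N + k - 1 = k + (2 ^ N - 1))%N; [move=> -> ->|lia].
Qed.

(** The excess t - s is spent on a geometric factor, written as a square because it is to be
    compared with the squares in the energy. *)
Lemma two_powR (s t : R) n :
   (2 ^- n : R) `^ t = (2 `^ (- s)) ^+ n * (2 `^ (- ((t - s) / 2))) ^+ n ^+ 2.
Proof.
rewrite -exprVn half_powR -exprM mulnC exprM -exprMn.
rewrite -[X in _ * X]powR_mulrn ?powR_ge0// -powRrM -powRD ?pnatr_eq0 ?implybT//.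
by congr (_ `^ _ ^+ _); field.
Qed.

(** A Chebyshev argument: the neighbourhoods where [f n k] is at least [a * beta ^+ n] cover [E],
    and their gauge sum is at most 3^t / a^2 times the energy of [f]. *)
Lemma capacity0_hausdorff (s t : R) (E : set R) : 0 < s < t ->
  (forall c, 0 < c -> dyadic_capacity_le (2 `^ (- s)) E c) ->
  hausdorff_measure (fun x y : R => `|x - y|) t E = 0%E.
Proof.
move=> /andP[s0 st] E0; apply/hausdorff_measure_eq0P => e d e0 d0.
pose b : R := 2 `^ (- s); pose beta : R := 2 `^ (- ((t - s) / 2)).
have b0 : 0 < b by rewrite powR_gt0.
have beta0 : 0 < beta by rewrite powR_gt0.
have beta1 : beta < 1 by apply: powR2N_lt1; lra.
(* With this [a] the series of 3 a beta^n sums to 1. A point covered only by unselected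
   neighbourhoods, at most three per level, would thus have potential at most 1. *)
have [a a0 aE] : exists2 a, 0 < a & a * 3 = 1 - beta.
  by exists ((1 - beta) / 3); [lra|field].
have t0 : 0 < t by lra.
have K0 : 0 < (3 : R) `^ t by rewrite powR_gt0.
have pow3 n : (3 / 2 ^+ n : R) `^ t = 3 `^ t * (b ^+ n * beta ^+ n ^+ 2).
  by rewrite powRM ?invr_ge0 ?exprn_ge0// (two_powR s t).
(* The bound by d^t on the whole sum bounds each single term (3 / 2^n)^t as well, which forces the
   selected intervals to have diameter at most [d]. *)
pose c := Num.min e (d `^ t) * (a ^+ 2 / 3 `^ t).
have c0 : 0 < c.
  by rewrite mulr_gt0 ?divr_gt0 ?exprn_gt0// lt_min e0 powR_gt0.
have [f [f0 fE] fc] := E0 c c0.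
pose B n k := if a * beta ^+ n <= f n k then dyadic_nbhd n k else set0.
pose G n k : R := if a * beta ^+ n <= f n k then (3 / 2 ^+ n) `^ t else 0.
have G0 n k : 0 <= G n k by rewrite /G; case: ifP => // _; exact: powR_ge0.
have sumG N : \sum_(n < N) \sum_(k < 2 ^ n) G n k <= Num.min e (d `^ t).
  have -> : Num.min e (d `^ t) = 3 `^ t / a ^+ 2 * c.
    by rewrite /c; field; rewrite !gt_eqF.
  apply: le_trans (_ : 3 `^ t / a ^+ 2 * energy (fun n _ => b ^+ n) N f <= _);
    last by rewrite ler_pM2l ?fc// divr_gt0// exprn_gt0.
  rewrite /energy -dyadic_sumZ; apply: ler_sum => n _; apply: ler_sum => k _.
  rewrite /G; case: ifP => [H|_]; last first.
    by rewrite !mulr_ge0 ?exprn_ge0 ?(ltW b0) ?invr_ge0 ?sqr_ge0// ltW.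
  rewrite pow3 (_ : _ * (_ / _ * _) = 3 `^ t * (b ^+ n * (f n k / a) ^+ 2)); last first.
    by field; rewrite gt_eqF.
  rewrite !ler_pM2l ?exprn_gt0// ler_sqr ?nnegrE ?divr_ge0 ?exprn_ge0//; try exact: ltW.
  by rewrite ler_pdivlMr// mulrC.
have Bsub n k : forall x y, B n k x -> B n k y -> `|x - y| <= 3 / 2 ^+ n.
  move=> x y; rewrite /B; case: ifP => // _.
  rewrite /dyadic_nbhd /= !in_itv/= => /andP[x1 x2] /andP[y1 y2].
  have -> : 3 / 2 ^+ n = (k%:R + 2) / 2 ^+ n - (k%:R - 1) / 2 ^+ n :> R by field.
  rewrite ler_norml; lra.
pose dist (x y : R) := `|x - y|.
have Bdiam n k : (diameter dist (B n k) <= (3 / 2 ^+ n)%R%:E)%E.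
  by apply: diameter_le => [|x y]; [rewrite divr_ge0|exact: Bsub].
have BG n k : (hausdorff_gauge dist t (B n k) <= (G n k)%:E)%E.
  rewrite /hausdorff_gauge; case: ifP => [_|Bn]; first by rewrite lee_fin.
  have -> : G n k = (3 / 2 ^+ n) `^ t.
    by rewrite /G; move: Bn; rewrite /B; case: ifP => // _; rewrite eqxx.
  rewrite -poweR_EFin gt0_ler_poweR ?(ltW t0)// in_itv/= leey andbT.
    exact: diameter_ge0.
  by rewrite lee_fin divr_ge0.
exists (fun i => B (heap_level i) (heap_pos i)); split.
- move=> x /fE[N Nx].
  have [n [k [kn ak xB]]] : exists n k, [/\ (k < 2 ^ n)%N, a * beta ^+ n <= f n k &
      dyadic_nbhd n k x].
    apply: contrapT => H; move: Nx; apply/negP; rewrite -leNgt.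
    apply: le_trans (_ : \sum_(n < N) a * 3 * beta ^+ n <= _).
      apply: ler_sum => n _.
      apply: le_trans (_ : \sum_(k < 2 ^ n) \1_(dyadic_nbhd n k) x * (a * beta ^+ n) <= _).
        apply: ler_sum => k _; rewrite indicE.
        have [/set_mem xU|] //= := boolP (x \in _); last by rewrite !mul0r.
        rewrite !mul1r; apply/ltW; rewrite ltNge; apply/negP => ak.
        by apply: H; exists n, k.
      rewrite -mulr_suml [leRHS]mulrAC [leRHS]mulrC.
      by rewrite ler_pM2r ?mulr_gt0 ?exprn_gt0// dyadic_nbhd_overlap.
    rewrite -mulr_sumr.
    rewrite aE; elim: (N) => [|M IH]; first by rewrite big_ord0 mulr0.
    have : (1 - beta) * \sum_(i < M) beta ^+ i = 1 - beta ^+ M.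
      by rewrite -opprB mulNr -subrX1 opprB.
    rewrite big_ord_recr/= mulrDr => ->.
    have := exprn_gt0 M.+1 beta0; rewrite exprS; lra.
  exists (2 ^ n + k - 1)%N => //.
  by have [-> ->] := heapK kn; rewrite /B ak.
- move=> i; have kn := heap_pos_lt i.
  set n := heap_level i in kn *; set k := heap_pos i in kn *.
  have [H|H] := boolP (a * beta ^+ n <= f n k); last first.
    rewrite /B (negbTE H); apply: diameter_le => //; exact: ltW.
  apply: le_trans (Bdiam n k) _; rewrite lee_fin leNgt; apply/negP => dn.
  have : d `^ t < (3 / 2 ^+ n) `^ t.
    by apply: gt0_ltr_powR => //; rewrite nnegrE ?divr_ge0// ltW.
  apply/negP; rewrite -leNgt.
  apply: le_trans (_ : Num.min e (d `^ t) <= _); last by rewrite ge_min lexx orbT.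
  apply: le_trans (sumG n.+1).
  rewrite big_ord_recr/= (bigD1 (Ordinal kn))//= /G H addrCA lerDl addr_ge0//.
    by apply: sumr_ge0 => j _; apply: sumr_ge0 => l _; exact: G0.
  by apply: sumr_ge0 => j _; exact: G0.
apply: nneseries_le => [i|N]; first exact: hausdorff_gauge_ge0.
apply: le_trans (_ : (\sum_(0 <= i < 2 ^ N - 1)
    G (heap_level i) (heap_pos i))%R%:E <= _)%E; last first.
  by rewrite lee_fin sum_heap (le_trans (sumG N))// ge_min lexx.
(* The first N heap nodes lie on the levels below N, so complete levels bound the partial sum. *)
have N2 : (N <= 2 ^ N - 1)%N by rewrite leq_subRL ?expn_gt0// add1n ltn_expl.
rewrite [in leRHS](@big_cat_nat _ _ _ N)//= EFinD -[leLHS]adde0.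
apply: leeD; last by rewrite lee_fin sumr_ge0.
by rewrite -sumEFin; apply: lee_sum => i _; exact: BG.
Qed.

(** The value 2 at a single node makes the potential exceed 1; its square is the constant 4. *)
Lemma dyadic_capacity_le_nbhd (b : R) n k : 0 < b -> (k < 2 ^ n)%N ->
  dyadic_capacity_le b (dyadic_nbhd n k) (4 * b ^+ n).
Proof.
move=> b0 kn; pose f i j : R := if (i == n) && (j == k) then 2 else 0.
have f0 i j : 0 <= f i j by rewrite /f; case: ifP.
exists f; first split=> // x xU.
  exists n.+1; apply: lt_le_trans (_ : \1_(dyadic_nbhd n k) x * f n k <= _).
    by rewrite indicE mem_set// /f !eqxx mul1r ltr1n.
  by apply: dyadic_sum_term => // i j; rewrite indicE.
suff eE N : energy (fun n _ => b ^+ n) N f = if (n < N)%N then 4 * b ^+ n else 0.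
  suff le N : energy (fun n _ => b ^+ n) N f <= 4 * b ^+ n by exact: le.
  by rewrite eE; case: ifP => // _; rewrite mulr_ge0// exprn_ge0// ltW.
elim: N=> [|N IH]; first by rewrite /energy dyadic_sum0.
transitivity (energy (fun n _ => b ^+ n) N f +
    \sum_(j < 2 ^ N) b ^+ N * f N j ^+ 2); first exact: dyadic_sumS.
rewrite IH ltnS.
have [<-|nN] := eqVneq n N; last first.
  rewrite big1 ?addr0 ?ltn_neqAle ?nN// => j _.
  by rewrite /f eq_sym (negbTE nN) expr0n mulr0.
rewrite ltnn leqnn add0r (bigD1 (Ordinal kn))//= big1 ?addr0; last first.
  move=> j jk; rewrite /f (_ : (j == k :> nat) = false) ?andbF ?expr0n ?mulr0//.
  by apply: contraNF jk => /eqP jk; apply/eqP/val_inj.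
by rewrite /f !eqxx /= mulrC; congr (_ * _); rewrite -natrX.
Qed.

End dyadic_capacity.

(** * Measures on the dyadic tree and the Frostman lemma *)

Section mass_splitting.
Context {R : realType}.

(* When [c] is subadditive on dyadic intervals, this proportional splitting
   keeps the mass below [c]. *)
Fixpoint split_mass (c : nat -> nat -> R) n k : R :=
  if n is n'.+1 then
    split_mass c n' k./2 * (c n k / (c n k./2.*2 + c n k./2.*2.+1))
  else if k == 0%N then c 0%N 0%N else 0.

Variable c : nat -> nat -> R.
Hypothesis c_ge0 : forall n k, 0 <= c n k.
Hypothesis c_sub : forall n k, c n k <= c n.+1 k.*2 + c n.+1 k.*2.+1.
Local Notation m := (split_mass c).

Lemma split_mass_ge0 n k : 0 <= m n k.
Proof.
elim: n k => [|n IH] k /=; first by case: ifP.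
by rewrite mulr_ge0 ?divr_ge0 ?addr_ge0.
Qed.

(** By induction the parent carries at most its own [c], hence at most the sum of the children's
    [c], and the proportional share cancels that sum. *)
Lemma split_mass_le n k : m n k <= c n k.
Proof.
elim: n k => [|n IH] k; first by rewrite /=; case: eqP => [->|].
rewrite /=; set S := _ + _.
have [S0|S0] := eqVneq S 0; first by rewrite S0 invr0 !mulr0.
have S_gt0 : 0 < S by rewrite lt_neqAle eq_sym S0 addr_ge0.
rewrite mulrA ler_pdivrMr// mulrC ler_wpM2l// (le_trans (IH _))//.
Qed.

(** When both children have [c] equal to 0 the quotient is 0 by convention. No mass is lost, since
    the parent's mass is then squeezed to 0 by [split_mass_le] and subadditivity. *)
Lemma split_massD n k : m n k = m n.+1 k.*2 + m n.+1 k.*2.+1.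
Proof.
rewrite /= doubleK uphalf_double -mulrDr -mulrDl; set S := _ + _.
have [S0|S0] := eqVneq S 0; last by rewrite divff// mulr1.
rewrite S0 mul0r mulr0; apply/eqP; rewrite eq_le split_mass_ge0 andbT.
by rewrite (le_trans (split_mass_le n k))// -S0 c_sub.
Qed.

Lemma split_mass_out n k : (2 ^ n <= k)%N -> m n k = 0.
Proof.
elim: n k => [|n IH] k nk /=; first by case: eqP nk => // ->.
by rewrite IH ?mul0r// geq_half_double -mul2n -expnS.
Qed.

End mass_splitting.

(** * From consistent dyadic masses to a probability measure *)

Section dyadic_measure.
Context {R : realType}.
Variables (m : nat -> nat -> R) (C b : R).
Hypothesis m_ge0 : forall n k, 0 <= m n k.
Hypothesis mD : forall n k, m n k = m n.+1 k.*2 + m n.+1 k.*2.+1.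
Hypothesis m00 : m 0 0 = 1.
Hypothesis m0S : forall k, m 0 k.+1 = 0.
Hypothesis m_le : forall n k, m n k <= C * b ^+ n.
Hypothesis b01 : 0 < b < 1.

Let S n K : R := \sum_(k < K) m n k.

Let S_homo n K L : (K <= L)%N -> S n K <= S n L.
Proof.
move=> KL; rewrite /S -!(big_mkord xpredT (m n)).
by rewrite (@big_cat_nat _ _ _ K 0 L)//= lerDl sumr_ge0.
Qed.

Let S_double n j K : S (n + j) (K * 2 ^ j) = S n K.
Proof.
elim: j n K => [|j IH] n K; first by rewrite addn0 muln1.
rewrite addnS -addSn expnS mulnA IH {IH} muln2.
rewrite /S; elim: K => [|K IH]; first by rewrite double0 !big_ord0.
by rewrite doubleS !big_ord_recr/= IH -addrA -mD.
Qed.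

Let S_0 K : S 0 K = (0 < K)%:R.
Proof.
rewrite /S; case: K => [|K]; first by rewrite big_ord0.
by rewrite big_ord_recl m00 big1 ?addr0// => i _; rewrite m0S.
Qed.

Let S_le1 n K : S n K <= 1.
Proof.
apply: le_trans (S_homo n (leq_pmulr K (expn_gt0 2 n : (0 < 2 ^ n)%N))) _.
by rewrite -[n in S n]add0n S_double S_0 lern1 leq_b1.
Qed.

(** The mass of the level-n intervals lying to the left of x: a lower approximation of the
    distribution function that increases with n. For negative x the truncation is 0, and so is the
    sum. *)
Let Sx n (x : R) := S n (Num.truncn (x * 2 ^+ n)).

Let Sx_homo x : {homo Sx ^~ x : i j / (i <= j)%N >-> i <= j}.
Proof.
move=> i j /subnK <-; rewrite addnC; set l := (j - i)%N.
rewrite /Sx -(S_double i l); apply: S_homo.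
have [x0|x0] := ltP x 0.
  have t0 k : Num.truncn (x * 2 ^+ k) = 0%N.
    apply/eqP; rewrite -leqn0 truncn_le_nat (lt_trans _ ltr01)//.
    by rewrite pmulr_llt0// exprn_gt0.
  by rewrite !t0.
rewrite truncn_ge_nat ?mulr_ge0 ?exprn_ge0// natrM natrX exprD mulrA.
by rewrite ler_wpM2r ?exprn_ge0// truncn_le mulr_ge0 ?exprn_ge0.
Qed.

Let S_trunc n i x : Sx i x <= S n (Num.truncn (x * 2 ^+ n)).+1.
Proof.
apply: (@le_trans _ _ (Sx (n + i) x)); first by apply: Sx_homo; exact: leq_addl.
rewrite -(S_double n i); apply: S_homo.
rewrite -ltnS.
have [x0|x0] := ltP x 0.
  have -> : Num.truncn (x * 2 ^+ (n + i)) = 0%N.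
    apply/eqP; rewrite -leqn0 truncn_le_nat (lt_trans _ ltr01)//.
    by rewrite pmulr_llt0// exprn_gt0.
  by [].
rewrite ltnS ltnW// truncn_lt_nat ?mulr_ge0 ?exprn_ge0//.
by rewrite natrM natrX exprD mulrA ltr_pM2r ?exprn_gt0// truncnS_gt.
Qed.

Let F x : R := sup (range (Sx ^~ x)).

Let has_supF x : has_sup (range (Sx ^~ x)).
Proof.
split; first by exists (Sx 0 x); exists 0%N.
by exists 1 => _ [n _ <-]; exact: S_le1.
Qed.

Let F_ge n x : Sx n x <= F x.
Proof. by apply: ub_le_sup; [exact: (has_supF x).2|exists n]. Qed.

Let F_le n x : F x <= S n (Num.truncn (x * 2 ^+ n)).+1.
Proof.
apply: ge_sup => [|_ [i _ <-]]; last exact: S_trunc.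
by exists (Sx 0 x); exists 0%N.
Qed.

Let F_homo : {homo F : x y / x <= y}.
Proof.
move=> x y xy; apply: ge_sup => [|_ [i _ <-]]; first by exists (Sx 0 x); exists 0%N.
apply: le_trans (F_ge i y); apply: S_homo; apply: le_truncn.
by rewrite ler_wpM2r// exprn_ge0.
Qed.

Let F_dyadic n k : F (k%:R / 2 ^+ n) = \sum_(j < k) m n j.
Proof.
have Sk i : Sx (n + i) (k%:R / 2 ^+ n) = S n k.
  rewrite /Sx (_ : _ * _ = (k * 2 ^ i)%:R); first by rewrite natrK S_double.
  by rewrite natrM natrX exprD mulrA divfK// gt_eqF// exprn_gt0.
apply/le_anti/andP; split; last first.
  by have := F_ge n (k%:R / 2 ^+ n); rewrite -[X in Sx X]addn0 Sk.
apply: ge_sup => [|_ [i _ <-]]; first by exists (Sx 0 (k%:R / 2 ^+ n)); exists 0%N.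
by rewrite -/(S n k) -(Sk i); apply: Sx_homo; exact: leq_addl.
Qed.

Let F_le0 x : x <= 0 -> F x = 0.
Proof.
move=> x0; have := F_dyadic 0 0; rewrite mul0r big_ord0 => F0.
apply/le_anti/andP; split; first by rewrite -F0 F_homo.
by apply: le_trans (F_ge 0 x); exact: sumr_ge0.
Qed.

Let F_ge1 x : 1 <= x -> F x = 1.
Proof.
move=> x1; have := F_dyadic 0 1; rewrite expr0 divr1 big_ord1 m00 => F1.
apply/le_anti/andP; split; last by rewrite -F1 F_homo.
by apply: ge_sup => [|_ [i _ <-]]; [exists (Sx 0 x); exists 0%N|exact: S_le1].
Qed.

(** An interval of length 2^(-n) starting in the dyadic interval of index t ends in it or in the
    next one, hence the factor 2. *)
Let F_inc n x y : x <= y <= x + 2^-1 ^+ n -> F y - F x <= 2 * (C * b ^+ n).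
Proof.
move=> /andP[xy yx]; set t := Num.truncn (x * 2 ^+ n).
have yt : (Num.truncn (y * 2 ^+ n) <= t.+1)%N.
  rewrite truncn_le_nat -[t.+2%:R]natr1 (@le_lt_trans _ _ (x * 2 ^+ n + 1))//; last first.
    by rewrite ltrD2r truncnS_gt.
  apply: le_trans (_ : (x + 2^-1 ^+ n) * 2 ^+ n <= _).
    by rewrite ler_wpM2r// exprn_ge0.
  by rewrite mulrDl exprVn mulVf// gt_eqF// exprn_gt0.
have h1 : F y <= S n t.+2 by apply: le_trans (F_le n y) _; exact: S_homo.
have h2 : S n t <= F x := F_ge n x.
have h3 : S n t.+2 = S n t + m n t + m n t.+1 by rewrite /S !big_ord_recr.
have := m_le n t; have := m_le n t.+1; lra.
Qed.

Let F_cont : right_continuous F.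
Proof.
move=> x; apply/cvgrPdist_le => e e0.
have [n ne] : exists n, 2 * (C * b ^+ n) <= e.
  have cvb : 2 * (C * b ^+ n) @[n --> \oo] --> (2 * (C * 0) : R).
    apply: cvgMr; apply: cvgMr; apply: cvg_expr.
    by have /andP[b0 b1] := b01; rewrite ger0_norm ?ltW.
  have /cvgrPdist_le/(_ e e0)[n _ /(_ n (leqnn n))] := cvb.
  rewrite !mulr0 sub0r normrN /= => h; exists n.
  exact: le_trans (ler_norm _) h.
near=> y; have xy : x <= y by near: y; exact: nbhs_right_ge.
rewrite distrC ger0_norm ?subr_ge0 ?F_homo// (le_trans _ ne)// F_inc//.
rewrite xy /=; near: y; apply: nbhs_right_le.
by rewrite ltrDl exprn_gt0.
Unshelve. all: by end_near. Qed.

HB.instance Definition _ := isCumulative.Build R _ R F F_homo F_cont.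

Let F_Ny : F @ -oo --> (0 : R).
Proof.
by apply: cvg_near_cst; near=> x; apply: F_le0; near: x; exact: nbhs_ninfty_le.
Unshelve. all: by end_near. Qed.

Let F_y : F @ +oo --> (1 : R).
Proof.
by apply: cvg_near_cst; near=> x; apply: F_ge1; near: x; exact: nbhs_pinfty_ge.
Unshelve. all: by end_near. Qed.

HB.instance Definition _ := isCumulativeBounded.Build R 0 1 F F_Ny F_y.

(** The Lebesgue-Stieltjes measure of [F], which is continuous from the right because its increments
    at scale 2^(-n) are O(b^n) with b < 1. *)
Lemma dyadic_measure : exists (mu : probability (measurableTypeR R) R) (G : R -> R),
  [/\ forall x y, x <= y -> mu `]x, y]%classic = (G y - G x)%:E,
      forall x, x <= 0 -> G x = 0,
      forall x, 1 <= x -> G x = 1,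
      forall n k, G (k%:R / 2 ^+ n) = \sum_(j < k) m n j &
      forall n x y, x <= y <= x + 2^-1 ^+ n -> G y - G x <= 2 * (C * b ^+ n)].
Proof.
exists (lebesgue_stieltjes_measure F : probability (measurableTypeR R) R), F.
split=> // x y xy; rewrite /= /lebesgue_stieltjes_measure.
rewrite /measure_extension measurable_mu_extE/=; last exact: is_ocitv.
by rewrite wlength_itv_bnd.
Qed.

End dyadic_measure.

(** * Frostman's lemma for compact and for analytic sets *)

Section frostman.
Context {R : realType}.

Lemma frostman_compact (K : set R) (b c : R) :
  compact K -> K `<=` `[0, 1] -> 0 < b < 1 -> 0 < c ->
  ~ dyadic_capacity_le b K c ->
  exists (mu : probability (measurableTypeR R) R) (C : R),
    [/\ 0 < C, mu (~` K) = 0%E, 2^-1 <= b &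
      forall n (u : R), (mu `](u - 2^-1 ^+ n)%R, (u + 2^-1 ^+ n)%R]%classic <= (C * b ^+ n)%R%:E)%E].
Proof.
move=> cK K01 /andP[b0 b1] c0 Kc.
pose S A := [set r | dyadic_capacity_le b A r].
pose cap A := inf (S A).
pose I n k : set R := `[k%:R / 2 ^+ n, k.+1%:R / 2 ^+ n]%classic.
have bn0 n (k : nat) : 0 < b ^+ n by rewrite exprn_gt0.
have lbS A : lbound (S A) 0 by move=> r /capacity_le_ge0; apply.
(* The root neighbourhood ]-1, 2[ contains [0, 1]. This keeps the sets of admissible bounds
   nonempty, so that their infima behave like capacities. *)
have S4 A : A `<=` `[0, 1] -> S A 4.
  move=> A01; rewrite /S /= -[4]mulr1 -(expr0 b).
  apply: capacity_leS (dyadic_capacity_le_nbhd b0 (isT : 0 < 2 ^ 0)%N) => //.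
  by move=> x /A01; rewrite /dyadic_nbhd /= !in_itv/= expr0; lra.
have cap_ge0 A : 0 <= cap A.
  rewrite /cap; have [->|S0] := eqVneq (S A) set0; first by rewrite inf0.
  by apply: lb_le_inf => //; exact/set0P.
have cap_le A r : S A r -> cap A <= r by move=> Sr; apply: ge_inf => //; exists 0.
have capU A B D : A `<=` `[0, 1] -> B `<=` `[0, 1] -> D `<=` A `|` B ->
    cap D <= cap A + cap B.
  move=> A01 B01 DAB; rewrite -lerBlDr; apply: lb_le_inf; first by exists 4; exact: S4.
  move=> r Ar; rewrite lerBlDr -lerBlDl; apply: lb_le_inf; first by exists 4; exact: S4.
  move=> r' Br'; rewrite lerBlDl; apply: cap_le.
  exact: capacity_leS DAB (lexx _) (capacity_leU Ar Br').
have KI n k : K `&` I n k `<=` `[0, 1] by move=> x [/K01].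
pose cc n k := cap (K `&` I n k).
have ccD n k : cc n k <= cc n.+1 k.*2 + cc n.+1 k.*2.+1.
  apply: capU => // x [Kx]; rewrite /I /= !in_itv/= => /andP[kx xk].
  have e1 : k.*2%:R / 2 ^+ n.+1 = k%:R / 2 ^+ n :> R.
    by rewrite -muln2 natrM exprS; field; rewrite gt_eqF// exprn_gt0.
  have e2 : k.*2.+2%:R / 2 ^+ n.+1 = k.+1%:R / 2 ^+ n :> R.
    by rewrite -doubleS -muln2 natrM exprS; field; rewrite gt_eqF// exprn_gt0.
  rewrite e1 e2.
  have [xl|xl] := leP x (k.*2.+1%:R / 2 ^+ n.+1); [left|right]; split => //.
    by apply/andP.
  by apply/andP; split; first exact: ltW.
have cc_le n k : (k < 2 ^ n)%N -> cc n k <= 4 * b ^+ n.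
  move=> kn; apply: cap_le; apply: capacity_leS (dyadic_capacity_le_nbhd b0 kn) => //.
  move=> x [_]; rewrite /I /dyadic_nbhd /= !in_itv/= -natr1 => /andP[kx xk].
  have p0 : (0 : R) < 2 ^- n by rewrite invr_gt0 exprn_gt0.
  apply/andP; split.
    by apply: lt_le_trans kx; rewrite ltr_pM2r//; lra.
  by apply: le_lt_trans xk _; rewrite ltr_pM2r//; lra.
have I00 : cc 0%N 0%N = cap K.
  rewrite /cc (_ : _ `&` _ = K)//; apply/seteqP; split=> [x []//|x Kx]; split=> //.
  by rewrite /I /= expr0 !divr1; exact: K01.
have cc0 : 0 < cc 0%N 0%N.
  rewrite I00 (lt_le_trans c0)//; apply: lb_le_inf; first by exists 4; exact: S4.
  move=> r Kr; rewrite leNgt; apply/negP => rc; apply: Kc.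
  by apply: capacity_leS Kr => //; exact: ltW.
pose M := cc 0%N 0%N.
have cc_ge0 n k : 0 <= cc n k by exact: cap_ge0.
pose m n k := split_mass cc n k / M.
have m_ge0 n k : 0 <= m n k by rewrite divr_ge0 ?split_mass_ge0 ?ltW.
have m_cc n k : m n k <= cc n k / M.
  by rewrite ler_pM2r ?invr_gt0// split_mass_le.
have m_le n k : m n k <= 4 / M * b ^+ n.
  have [kn|kn] := ltnP k (2 ^ n).
    by rewrite (le_trans (m_cc n k))// mulrAC ler_pM2r ?invr_gt0 ?cc_le.
  by rewrite /m split_mass_out// mul0r !mulr_ge0 ?exprn_ge0 ?invr_ge0 ?ltW.
have mD n k : m n k = m n.+1 k.*2 + m n.+1 k.*2.+1.
  by rewrite /m -mulrDl -split_massD.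
have m00 : m 0%N 0%N = 1 by rewrite /m divff// gt_eqF.
have m0S k : m 0%N k.+1 = 0 by rewrite /m /= mul0r.
have b01 : 0 < b < 1 by rewrite b0.
have [mu [G [muG G0 G1 Gm Ginc]]] := dyadic_measure m_ge0 mD m00 m0S m_le b01.
(* Each half of ]u - 2^(-n), u + 2^(-n)] has mass at most 2 (4 / M) b^n. *)
exists mu, (16 / M); split.
- by rewrite divr_gt0.
- have closedK : closed K by apply: compact_closed => //; exact: Rhausdorff.
  have mK : measurable (~` K : set (measurableTypeR R)).
    by apply: measurableC; exact: closed_measurable.
  apply: measure_negligible => //.
  pose L (x y : R) : set R := `]x, y]%classic.
  have muL x y : x <= y -> mu (L x y) = (G y - G x)%:E by exact: muG.
  pose J n k : set R := `]k%:R / 2 ^+ n, k.+1%:R / 2 ^+ n]%classic.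
  have muJ n k : K `&` I n k = set0 -> mu.-negligible (J n k).
    move=> KIn; exists (J n k); split => //; first exact: measurable_itv.
    rewrite /J muG; last by rewrite ler_pM2r ?ler_nat// invr_gt0 exprn_gt0.
    rewrite !Gm big_ord_recr/= addrC addrK.
    congr EFin; apply/le_anti; rewrite m_ge0 andbT.
    rewrite (le_trans (m_cc n k))// /cc KIn.
    suff -> : cap set0 = 0 by rewrite mul0r.
    apply/le_anti; rewrite cap_ge0 andbT; apply/ler_addgt0Pr => e e0.
    by rewrite add0r; apply: cap_le; apply: capacity_le_set0; exact: ltW.
  (* As [K] is closed, every point of ]0, 1] outside [K] lies in some [J n k] whose closure [I n k]
     misses [K]. These countably many intervals are null because the empty set has capacity 0. *)
  pose Z n k := if K `&` I n k == set0 then J n k else set0.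
  have muZ : mu.-negligible (\bigcup_n \bigcup_k Z n k).
    apply: (@negligible_bigcup _ _ _ mu (fun n => \bigcup_k Z n k)) => n.
    apply: (@negligible_bigcup _ _ _ mu (Z n)) => k.
    by rewrite /Z; case: eqP => [KJ|_]; [exact: muJ|exact: negligible_set0].
  have mu0 : mu.-negligible (\bigcup_j L (- j%:R) 0).
    apply: (@negligible_bigcup _ _ _ mu (fun j => L (- j%:R) 0)) => j.
    exists (L (- j%:R) 0); split; [exact: measurable_itv| |by []].
    transitivity (G 0 - G (- j%:R))%:E; first by apply: muL; rewrite oppr_le0.
    by rewrite !G0 ?subrr// oppr_le0.
  have mu1 : mu.-negligible (\bigcup_j L 1 j.+1%:R).
    apply: (@negligible_bigcup _ _ _ mu (fun j => L 1 j.+1%:R)) => j.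
    exists (L 1 j.+1%:R); split; [exact: measurable_itv| |by []].
    transitivity (G j.+1%:R - G 1)%:E; first by apply: muL; rewrite ler1n.
    by rewrite !G1 ?subrr// ler1n.
  apply: negligibleS (negligibleU (negligibleU mu0 mu1) muZ) => x Kx.
  have [x0|x0] := leP x 0.
    left; left; exists (Num.truncn (- x)).+1 => //.
    by rewrite /L /= in_itv/= x0 andbT ltrNl truncnS_gt.
  have [x1|x1] := ltP 1 x.
    left; right; exists (Num.truncn x) => //.
    by rewrite /L /= in_itv/= x1/= ltW// truncnS_gt.
  right.
  have /nbhs_ballP[e /= e0 xe] : nbhs x (~` K).
    by apply: open_nbhs_nbhs; split => //; exact: closed_openC.
  have [n ne] : exists n, 2^-1 ^+ n < e.
    have /cvgrPdist_lt/(_ e e0)[n _ /(_ n (leqnn n))] :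
        2^-1 ^+ n @[n --> \oo] --> (0 : R) by apply: cvg_expr; rewrite ger0_norm; lra.
    by rewrite /= sub0r normrN => h; exists n; exact: le_lt_trans (ler_norm _) h.
  have n0 : (0 : R) < 2 ^+ n by rewrite exprn_gt0.
  have [k kx] : exists k : nat, k%:R < x * 2 ^+ n <= k.+1%:R.
    have y0 : 0 < x * 2 ^+ n by rewrite mulr_gt0.
    have /andP[] := truncn_itv (ltW y0); set t := Num.truncn _.
    rewrite le_eqVlt => /predU1P[ty|ty] yt; last by exists t; rewrite ty ltW.
    case: t ty yt => [t0|t ty _]; first by move: y0; rewrite -t0 ltxx.
    by exists t; rewrite -ty ltr_nat lexx ltnSn.
  exists n => //; exists k => //; rewrite /Z.
  have xJ : k%:R / 2 ^+ n < x <= k.+1%:R / 2 ^+ n.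
    by rewrite ltr_pdivrMr// ler_pdivlMr.
  case: eqP => [_|H]; first by rewrite /J /= in_itv/=.
  exfalso; apply: H; rewrite -subset0 => y [Ky]; rewrite /I /= in_itv/=.
  move=> /andP[ky yk]; apply: (xe y) => //; apply: le_lt_trans ne.
  move: xJ => /andP[kx' xk'].
  have : k.+1%:R / 2 ^+ n = k%:R / 2 ^+ n + 2^-1 ^+ n :> R.
    by rewrite -natr1 mulrDl mul1r exprVn.
  by rewrite ler_norml; lra.
(* The total mass 1 is carried by 2^n intervals of mass at most (4 / M) b^n, which is impossible for
   large n if 2 b < 1. *)
- rewrite leNgt; apply/negP => b2.
  have b21 : `|2 * b| < 1 by rewrite ger0_norm; lra.
  have /cvgrPdist_lt/(_ 1 ltr01)[n _ /(_ n (leqnn n))] :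
      4 / M * (2 * b) ^+ n @[n --> \oo] --> (4 / M * 0 : R).
    by apply: cvgMr; exact: cvg_expr.
  rewrite /= mulr0 sub0r normrN; apply/negP; rewrite -leNgt.
  apply: le_trans (ler_norm _).
  have n0 : (0 : R) < 2 ^+ n by rewrite exprn_gt0.
  have := Gm n (2 ^ n)%N; rewrite natrX divff ?gt_eqF// G1// => {1}->.
  apply: le_trans (_ : \sum_(j < 2 ^ n) 4 / M * b ^+ n <= _).
    by apply: ler_sum => j _; exact: m_le.
  rewrite sumr_const card_ord -[leLHS]mulr_natr natrX exprMn.
  by rewrite -mulrA (mulrC (b ^+ n)).
- move=> n u; have p0 : (0 : R) < 2^-1 ^+ n by rewrite exprn_gt0.
  rewrite muG; last by rewrite lerD2l ge0_cp// ltW.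
  rewrite lee_fin.
  have h1 := @Ginc n (u - 2^-1 ^+ n) u; have h2 := @Ginc n u (u + 2^-1 ^+ n).
  have -> : 16 / M * b ^+ n = 2 * (4 / M * b ^+ n) + 2 * (4 / M * b ^+ n) by field; rewrite gt_eqF.
  have {}h1 : G u - G (u - 2^-1 ^+ n) <= 2 * (4 / M * b ^+ n) by apply: h1; apply/andP; split; lra.
  have {}h2 : G (u + 2^-1 ^+ n) - G u <= 2 * (4 / M * b ^+ n) by apply: h2; apply/andP; split; lra.
  lra.
Qed.

Lemma frostman_analytic (E : set R) (s t : R) :
  analytic_set E -> E `<=` `[0, 1] -> 0 < s < t ->
  hausdorff_measure (fun x y : R => `|x - y|) t E != 0%E ->
  exists (K : set R) (mu : probability (measurableTypeR R) R) (C : R),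
    [/\ compact K, K `<=` E, mu (~` K) = 0%E, s <= 1 & 0 < C /\
      forall n (u : R), (mu `](u - 2^-1 ^+ n)%R, (u + 2^-1 ^+ n)%R]%classic <=
        (C * (2 `^ (- s)) ^+ n)%R%:E)%E].
Proof.
move=> anE E01 st Et; have /andP[s0 _] := st.
pose b : R := 2 `^ (- s).
have b0 : 0 < b by rewrite powR_gt0.
have b1 : b < 1 by exact: powR2N_lt1.
have [c c0 Ec] : exists2 c, 0 < c & ~ dyadic_capacity_le b E c.
  apply: contrapT => H; move/eqP: Et; apply; apply: capacity0_hausdorff st _.
  by move=> c c0; apply: contrapT => Ec; apply: H; exists c.
case: anE => [E0|[f [cf fE]]].
  by exfalso; apply: Ec; rewrite E0; apply: capacity_le_set0; exact: ltW.
have w0 (n k : nat) : 0 < b ^+ n by rewrite exprn_gt0.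
have oU n k : open (dyadic_nbhd n k : set R) by exact: interval_open.
have [K [cK KE Kc]] : exists K, [/\ compact K, K `<=` range f &
    ~ capacity_le dyadic_nbhd (fun n _ => b ^+ n) K (c / 2)].
  by apply: (capacity_le_analytic w0 oU cf (c := c)); [lra|rewrite fE].
have c2 : 0 < c / 2 by rewrite divr_gt0.
rewrite fE in KE.
have [|mu [C [C0 muK b2 muC]]] := frostman_compact cK (subset_trans KE E01) _ c2 Kc.
  by rewrite b0.
exists K, mu, C; split => //.
rewrite leNgt; apply/negP => s1; move: b2; apply/negP; rewrite -ltNge.
rewrite /b (_ : - s = -1 + - (s - 1)); last by ring.
rewrite powRD ?pnatr_eq0 ?implybT// powR_inv1// gtr_pMr//.
by apply: powR2N_lt1; lra.
Qed.

End frostman.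

(** * Small increments of the process *)

Section measurability.
Context {R : realType}.

Lemma measurable_coord d (i : 'I_d) :
  measurable_fun setT ((fun x => x 0 i) : borelRV R d -> R).
Proof.
apply: (measurability _ (RGenOpens.measurableE R)) => _ [_ [a [b ->] <-]].
rewrite setTI; apply: sub_sigma_algebra => /=.
by apply: open_comp => [x _|]; [exact: coord_continuous|exact: interval_open].
Qed.

(* The process is the limit of its right-endpoint step discretizations. *)
Lemma measurable_right_continuous dO (Omega : measurableType dO)
    (f : R -> Omega -> R) :
  (forall t, 0 <= t -> measurable_fun setT (f t)) ->
  (forall w t, 0 <= t -> f s w @[s --> t^'+] --> f t w) ->
  measurable_fun setT
    ((fun z => f (Num.max z.1 0) z.2) : measurableTypeR R * Omega -> R).
Proof.
move=> mf cf.
pose tk (n : nat) (u : R) := Num.truncn (Num.max u 0 * 2 ^+ n).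
(* The successor puts the grid point strictly to the right of [u], as the right limit requires. *)
pose tn (n : nat) (u : R) : R := (tk n u).+1%:R / 2 ^+ n.
pose h n (z : measurableTypeR R * Omega) : R := f (tn n z.1) z.2.
have p2 n : (0 : R) < 2 ^+ n by rewrite exprn_gt0.
have m0 (u : R) : 0 <= Num.max u 0 by rewrite le_max lexx orbT.
have mtk n k : measurable ([set u : measurableTypeR R | tk n u = k]).
  have -> : [set u | tk n u = k] =
      ((fun u => Num.max u 0 * 2 ^+ n) @^-1` `[k%:R, k.+1%:R[%classic).
    apply/seteqP; split => u /=; rewrite in_itv/=.
      by move=> <-; apply: truncn_itv; rewrite mulr_ge0// ltW.
    by move=> ku; apply/eqP; rewrite truncn_eq// mulr_ge0// ltW.
  rewrite -[X in measurable X]setTI.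
  have mg : measurable_fun setT (fun u : measurableTypeR R => Num.max u 0 * 2 ^+ n).
    by apply: measurable_funM => //; apply: measurable_maxr.
  by apply: mg => //; exact: measurable_itv.
apply: (@measurable_fun_cvg _ _ _ _ h) => [n|z _].
  move=> _ B mB; rewrite setTI.
  rewrite [X in measurable X](_ : _ =
    \bigcup_k ([set u : measurableTypeR R | tk n u = k] `*`
      (f (k.+1%:R / 2 ^+ n) @^-1` B))); last first.
    apply/seteqP; split => [[u w] /= Bw|[u w] [k _ [/= <-]]//].
    by exists (tk n u).
  apply: bigcup_measurable => k _; apply: measurableX => //.
  by rewrite -[X in measurable X]setTI; apply: mf => //; rewrite divr_ge0// ltW.
have /cvg_at_rightP := cf z.2 _ (m0 z.1).
apply; split=> [n|].
  by rewrite ltr_pdivlMr// truncnS_gt.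
apply/cvgrPdist_le => e e0.
have : 2^-1 ^+ n @[n --> \oo] --> (0 : R) by apply: cvg_expr; rewrite ger0_norm; lra.
move=> /cvgrPdist_le/(_ e e0); apply: filterS => n; rewrite sub0r normrN.
rewrite ger0_norm ?exprn_ge0// => ne.
have h1 : Num.max z.1 0 < tn n z.1 by rewrite ltr_pdivlMr// truncnS_gt.
have h2 : tn n z.1 <= Num.max z.1 0 + 2^-1 ^+ n.
  rewrite /tn -natr1 mulrDl mul1r exprVn lerD2r ler_pdivrMr// truncn_le.
  by rewrite mulr_ge0// ltW.
by rewrite distrC ger0_norm; lra.
Qed.

End measurability.

Section markov_increment.
Context {R : realType} {d : nat} {dO : measure_display}
  {Omega : measurableType dO}.
Variables (P : 'rV[R]_d -> probability Omega R) (X : R -> Omega -> 'rV[R]_d).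
Hypothesis fX : feller_process P X.

(** Closeness by coordinates fits boxes, whose volume is known, and makes measurability a question
    about real coordinates. Euclidean closeness implies it, which is the direction needed for
    covers. *)
Definition coord_close (r : R) (x y : 'rV[R]_d) :=
  forall i, `|x 0 i - y 0 i| <= r.

Lemma measurable_process_coord t i : 0 <= t ->
  measurable_fun setT (fun w => X t w 0 i).
Proof.
move=> t0; exact: (measurableT_comp (measurable_coord i) (fp_measurable fX t0)).
Qed.

Lemma measurable_coord_close t1 t2 r : 0 <= t1 -> 0 <= t2 ->
  measurable [set w | coord_close r (X t1 w) (X t2 w)].
Proof.
move=> t10 t20.
rewrite [X in measurable X](_ : _ = \bigcap_(i in [set: 'I_d])
    (fun w => `|X t1 w 0 i - X t2 w 0 i|) @^-1` `]-oo, r]%classic); last first.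
  apply/seteqP; split => w /= h i; [move=> _|]; have := h i; rewrite /= in_itv//=.
  by apply.
apply: fin_bigcap_measurable => // i _; rewrite -[X in measurable X]setTI.
have mi : measurable_fun setT (fun w => `|X t1 w 0 i - X t2 w 0 i|).
  apply: measurableT_comp => //.
  by apply: measurable_funB; exact: measurable_process_coord.
by apply: mi => //; exact: measurable_itv.
Qed.

Lemma measurable_box (A : 'I_d -> set R) : (forall i, measurable (A i)) ->
  measurable ([set y | forall i, A i (y 0 i)] : set (borelRV R d)).
Proof.
move=> mA.
rewrite [X in measurable X](_ : _ = \bigcap_(i in [set: 'I_d])
    (fun y : borelRV R d => y 0 i) @^-1` A i); last first.
  by apply/seteqP; split => y /= h i; [move=> _|]; have := h i => //; apply.
apply: fin_bigcap_measurable => // i _; rewrite -[X in measurable X]setTI.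
exact: measurable_coord.
Qed.

Lemma natural_filtration0 t : natural_filtration X t set0.
Proof. by move=> S [[S0 _ _] _]; exact: S0. Qed.

Lemma natural_filtrationT t : natural_filtration X t setT.
Proof.
by move=> S [[S0 SC _] _]; rewrite -(setD0 setT); exact: SC.
Qed.

(** The strong Markov property is applied at the deterministic time s, whose events {s <= r} are
    trivial. *)
Lemma markov_le x s t (A B : set (borelRV R d)) (k : \bar R) :
  0 <= s -> 0 <= t -> measurable A -> measurable B ->
  (forall y, (P y (X t @^-1` B) <= k)%E) ->
  (P x (X s @^-1` A `&` X (s + t)%R @^-1` B) <= k * P x (X s @^-1` A))%E.
Proof.
move=> s0 t0 mA mB Bk.
have mXA : measurable (X s @^-1` A).
  by rewrite -[X in measurable X]setTI; apply: (fp_measurable fX s0).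
have stop : stopping_time X (fun=> s%:E).
  split=> [w|r r0]; first by rewrite lee_fin.
  have [sr|sr] := leP s r.
    rewrite [X in natural_filtration _ _ X](_ : _ = setT); last first.
      by apply/seteqP; split => w //= _; rewrite lee_fin.
    exact: natural_filtrationT.
  rewrite [X in natural_filtration _ _ X](_ : _ = set0); last first.
    by apply/seteqP; split => w //=; rewrite lee_fin leNgt sr.
  exact: natural_filtration0.
have prior : prior_events X (fun=> s%:E) (X s @^-1` A).
  split=> // r r0; have [sr|sr] := leP s r.
    rewrite [X in natural_filtration _ _ X](_ : _ = X s @^-1` A); last first.
      by apply/seteqP; split => [w []//|w Aw]; split; rewrite //= lee_fin.
    apply: sub_sigma_algebra; exists s; first by rewrite /= in_itv/= s0.
    by exists A => //; rewrite setTI.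
  rewrite [X in natural_filtration _ _ X](_ : _ = set0); last first.
    by apply/seteqP; split => w //= [_]; rewrite lee_fin leNgt sr.
  exact: natural_filtration0.
have := fp_strong_markov fX x stop prior t0 mB.
rewrite (_ : [set _ | _ /\ _] = X (s + t) @^-1` B); last first.
  by apply/seteqP; split => [w []//|w Bw]; split=> //; exact: ltry.
move=> ->.
rewrite (_ : X s @^-1` A `&` _ = X s @^-1` A); last first.
  by apply/seteqP; split => [w []//|w Aw]; split=> //; exact: ltry.
rewrite -(integral_cst (P x) mXA k).
apply: ge0_le_integral => //.
apply: measurable_funTS.
exact: (measurableT_comp (fp_kernel fX t0 mB) (fp_measurable fX s0)).
Qed.

(** If [X s] is in a cube [Q z] of side r, closeness forces [X (s + t)] into the cube [Q3 z] of side
    3 r. Each such transition has probability at most k (3 r)^d, and the disjoint cubes [Q z] have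
    total probability at most 1. *)
Lemma increment_le x (s t r : R) (k : R) :
  0 <= s -> 0 <= t -> 0 < r -> 0 <= k ->
  (forall y (B : set (borelRV R d)), measurable B ->
    (P y (X t @^-1` B) <= k%:E * lebesgue_rV d B)%E) ->
  (P x [set w | coord_close r (X s w) (X (s + t)%R w)] <= (k * (3 * r) ^+ d)%:E)%E.
Proof.
move=> s0 t0 r0 k0 Bk.
pose Q (z : 'rV[int]_d) : set (borelRV R d) :=
  [set y | forall i, `[(z 0 i)%:~R * r, ((z 0 i)%:~R + 1) * r[%classic (y 0 i)].
pose Q3 (z : 'rV[int]_d) : set (borelRV R d) :=
  [set y | forall i, (\row_i (((z 0 i)%:~R - 1) * r)) 0 i <= y 0 i <=
     (\row_i (((z 0 i)%:~R + 2) * r)) 0 i].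
have mQ z : measurable (Q z).
  apply: (@measurable_box (fun i => `[(z 0 i)%:~R * r, ((z 0 i)%:~R + 1) * r[%classic)) => i.
  exact: measurable_itv.
have mQ3 z : measurable (Q3 z).
  rewrite [X in measurable X](_ : _ = [set y : borelRV R d | forall i,
     `[((z 0 i)%:~R - 1) * r, ((z 0 i)%:~R + 2) * r]%classic (y 0 i)]).
    apply: (@measurable_box
      (fun i => `[((z 0 i)%:~R - 1) * r, ((z 0 i)%:~R + 2) * r]%classic)) => i.
    exact: measurable_itv.
  by apply/seteqP; split => y h i; have := h i; rewrite /= in_itv/= !mxE.
have leb3 z : lebesgue_rV d (Q3 z) = ((3 * r) ^+ d)%:E.
  rewrite /Q3 lebesgue_rV_box => [|i]; last first.
    by rewrite !mxE ler_pM2r//; lra.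
  congr EFin; rewrite -[d in RHS]card_ord -prodr_const; apply: eq_bigr => i _.
  by rewrite !mxE; ring.
pose G n : set (borelRV R d) := if pickle_inv n is Some z then Q z else set0.
pose H n : set (borelRV R d) := if pickle_inv n is Some z then Q3 z else set0.
have mG n : measurable (G n) by rewrite /G; case: pickle_inv.
have mH n : measurable (H n) by rewrite /H; case: pickle_inv.
have XG n : measurable (X s @^-1` G n).
  by rewrite -[X in measurable X]setTI; apply: (fp_measurable fX s0).
have XH n : measurable (X (s + t) @^-1` H n).
  by rewrite -[X in measurable X]setTI; apply: (fp_measurable fX (addr_ge0 s0 t0)).
apply: (@le_trans _ _ (\sum_(0 <= n <oo) P x (X s @^-1` G n `&` X (s + t)%R @^-1` H n))%E).
  apply: measure_sigma_subadditive => [n||w /= cw].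
  - exact: measurableI.
  - by apply: measurable_coord_close => //; exact: addr_ge0.
  pose z : 'rV[int]_d := \row_i Num.floor (X s w 0 i / r).
  have zP i : (z 0 i)%:~R * r <= X s w 0 i < ((z 0 i)%:~R + 1) * r.
    have /andP[h1 h2] := real_floor_itv (num_real (X s w 0 i / r)).
    rewrite mxE -ler_pdivlMr// h1 -ltr_pdivrMr//.
    by move: h2; rewrite intrD.
  exists (pickle z) => //; split; rewrite /= /G /H pickleK_inv => i.
    by rewrite /= in_itv/=; exact: zP.
  have /andP[h1 h2] := zP i; have := cw i; rewrite ler_norml => /andP[h3 h4].
  rewrite [(\row_i ((_ - 1) * r)) 0 i]mxE [(\row_i ((_ + 2) * r)) 0 i]mxE.
  by rewrite !mulrDl mul1r in h2 *; apply/andP; split; lra.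
apply: (@le_trans _ _ (\sum_(0 <= n <oo) (k * (3 * r) ^+ d)%:E * P x (X s @^-1` G n))%E).
  apply: lee_nneseries => [n _ _|n _]; first exact: measure_ge0.
  apply: markov_le => // y.
  apply: le_trans (Bk y _ (mH n)) _; rewrite EFinM lee_wpmul2l ?lee_fin//.
  rewrite /H; case: pickle_inv => [z|]; first by rewrite leb3.
  by rewrite measure0 lee_fin exprn_ge0// mulr_ge0// ltW.
rewrite nneseriesZl; last by move=> n _; exact: measure_ge0.
rewrite -[leRHS]mule1 lee_wpmul2l//.
  by rewrite lee_fin mulr_ge0 ?exprn_ge0 ?mulr_ge0// ltW.
have mU : measurable (\bigcup_n X s @^-1` G n) by exact: bigcupT_measurable.
rewrite -measure_semi_bigcup//; first exact: probability_le1.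
apply/trivIsetP => m n _ _ mn; rewrite -preimage_setI.
suff -> : G m `&` G n = set0 by rewrite preimage_set0.
rewrite /G -subset0.
have := @pickle_invK 'rV[int]_d m; case: pickle_inv => [z /= zm|]; last by move=> _ y [].
have := @pickle_invK 'rV[int]_d n; case: pickle_inv => [z' /= zn|]; last by move=> _ y [].
move=> y [yz yz']; move/eqP: mn; apply; rewrite -zm -zn; congr pickle.
apply/rowP => i; have := yz i; have := yz' i; rewrite /= !in_itv/= => /andP[a1 a2] /andP[b1 b2].
have h1 : (z 0 i)%:~R < (z' 0 i)%:~R + 1 :> R by rewrite -(ltr_pM2r r0); lra.
have h2 : (z' 0 i)%:~R < (z 0 i)%:~R + 1 :> R by rewrite -(ltr_pM2r r0); lra.
by move: h1 h2; rewrite -!intrD1 !ltr_int !ltzD1 => h1 h2; apply/le_anti; rewrite h1 h2.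
Qed.

End markov_increment.

Section density_bound.
Context {R : realType}.

Context {d : nat} {dO : measure_display} {Omega : measurableType dO}.
Variables (P : 'rV[R]_d -> probability Omega R) (X : R -> Omega -> 'rV[R]_d)
  (p : R -> 'rV[R]_d -> 'rV[R]_d -> R) (a c : R).
Hypothesis d_gt0 : (0 < d)%N.
Hypothesis fX : feller_process P X.
Hypothesis pX : transition_density P X p.
Hypothesis a_gt0 : 0 < a.
Hypothesis a_le : a <= d%:R.
Hypothesis c_gt0 : 0 < c.
Hypothesis p_le : forall t x y, 0 < t <= 1 -> p t x y <= c * t `^ (- (d%:R / a)).

Let Dn0 : 0 < d%:R :> R. Proof. by rewrite ltr0n. Qed.

Lemma density_measure_le t y (B : set (borelRV R d)) : 0 < t <= 1 ->
  measurable B ->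
  (P y (X t @^-1` B) <= (c * t `^ (- (d%:R / a)))%:E * lebesgue_rV d B)%E.
Proof.
move=> t01 mB; have /andP[t0 t1] := t01.
rewrite (densityE pX y t0 mB) -integral_cst//.
apply: ge0_le_integral => //.
- by move=> z _; rewrite lee_fin; apply: density_ge0 pX _ _ _ t0.
- by apply/measurable_EFinP; apply: measurable_funTS; exact: density_measurable pX _ _ t0.
- by move=> z _; rewrite lee_fin p_le.
Qed.

Lemma close_prob_le (s : R) : 0 < s <= 1 ->
  exists2 C, 0 < C & forall x u v n j, 0 <= u <= 1 -> 0 <= v <= 1 ->
    2^-1 ^+ j.+1 <= `|u - v| ->
    (P x [set w | coord_close (2^-1 ^+ n) (X u w) (X v w)] <=
      (C * (2 `^ (- (a * s))) ^+ n * (2 `^ s) ^+ j)%:E)%E.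
Proof.
move=> /andP[s0 s1].
(* Since th <= 1, min(1, K) <= K^th. This exponent turns r^d into r^(a s) and t^(-d/a) into
   t^(-s). *)
pose th := a * s / d%:R.
have th0 : 0 < th by rewrite divr_gt0// mulr_gt0.
have th1 : th <= 1.
  by rewrite ler_pdivrMr// mul1r (le_trans _ a_le)// ler_piMr// ltW.
(* The factor 2^s absorbs the shift from j + 1 to j in the lower bound on |u - v|. *)
exists ((c * 3 ^+ d) `^ th * 2 `^ s).
  by rewrite mulr_gt0// powR_gt0// mulr_gt0// exprn_gt0.
move=> x u v n j; wlog uv : u v / u <= v.
  move=> H u01 v01 juv; have [uv|/ltW uv] := leP u v; first exact: H.
  rewrite (_ : [set w | _] = [set w | coord_close (2^-1 ^+ n) (X v w) (X u w)]).
    by apply: H => //; rewrite distrC.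
  by apply/seteqP; split => w /= h i; rewrite distrC; exact: h.
move=> /andP[u0 u1] /andP[v0 v1]; rewrite distrC ger0_norm ?subr_ge0//.
set t := v - u => jt.
have t0 : 0 < t by rewrite (lt_le_trans _ jt)// exprn_gt0.
have t1 : t <= 1 by rewrite /t; lra.
have t01 : 0 < t <= 1 by rewrite t0.
pose r : R := 2^-1 ^+ n; have r0 : 0 < r by rewrite exprn_gt0.
pose k := c * t `^ (- (d%:R / a)).
have k0 : 0 < k by rewrite mulr_gt0// powR_gt0.
have := @increment_le _ _ _ _ _ _ fX x u t r k u0 (ltW t0) r0 (ltW k0)
  (fun y B => @density_measure_le t y B t01).
rewrite (_ : u + t = v); last by rewrite /t addrC subrK.
set A := [set w | _]; set K := k * _ => PA.
have K0 : 0 < K by rewrite mulr_gt0// exprn_gt0// mulr_gt0.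
have PAth : (P x A <= (K `^ th)%:E)%E.
  have [K1|K1] := leP K 1.
    by apply: le_trans PA _; rewrite lee_fin ger1_powR// K0.
  apply: (@le_trans _ _ 1%E).
    by apply: probability_le1; apply: (measurable_coord_close fX).
  rewrite lee_fin; apply: (@le_trans _ _ (1 `^ th)); first by rewrite powR1.
  apply: ge0_ler_powR; rewrite ?nnegrE//; exact: ltW.
apply: le_trans PAth _; rewrite lee_fin.
have -> : K `^ th = (c * 3 ^+ d) `^ th * t `^ (- s) * r `^ (a * s).
  have -> : K = (c * 3 ^+ d) * t `^ (- (d%:R / a)) * r `^ d%:R.
    by rewrite /K /k powR_mulrn ?(ltW r0)// exprMn; ring.
  rewrite powRM ?mulr_ge0 ?powR_ge0 ?exprn_ge0 ?(ltW c_gt0)//.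
  rewrite powRM ?mulr_ge0 ?powR_ge0 ?exprn_ge0 ?(ltW c_gt0)//.
  rewrite -!powRrM; congr (_ * _ `^ _ * _ `^ _).
    by rewrite /th; field; rewrite !gt_eqF.
  by rewrite /th; field; rewrite !gt_eqF.
rewrite half_powR -!mulrA; apply: ler_wpM2l; first exact: powR_ge0.
rewrite mulrC [leRHS]mulrCA; apply: ler_wpM2l; first by rewrite exprn_ge0// powR_ge0.
rewrite -exprS -[2 `^ s]/(2 `^ s); have -> : 2 `^ s = 2 `^ (- - s) by rewrite opprK.
rewrite -half_powR !powRN lef_pV2 ?posrE ?powR_gt0// ?exprn_gt0//.
by apply: ge0_ler_powR; rewrite ?nnegrE ?exprn_ge0// ltW.
Qed.

End density_bound.

(** * Sections of random sets *)

Section random_sections.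
Context {R : realType}.

Lemma geometric_sum_le (x : R) N : 0 <= x < 1 -> \sum_(0 <= i < N) x ^+ i <= (1 - x)^-1.
Proof.
move=> /andP[x0 x1]; rewrite -[leRHS]mul1r ler_pdivlMr ?subr_gt0// mulrC.
have := subrX1 x N; rewrite -(big_mkord xpredT (fun i => x ^+ i)) => E.
rewrite -opprB mulNr -E opprB lerBlDr lerDl exprn_ge0//.
Qed.

Lemma nneseries_geometric_le (c x : R) : 0 <= c -> 0 <= x < 1 ->
  (\sum_(0 <= i <oo) (c * x ^+ i)%:E <= (c / (1 - x))%:E)%E.
Proof.
move=> c0 x01; have x0 : 0 <= x by case/andP: x01.
apply: nneseries_le => [i|N]; first by rewrite lee_fin mulr_ge0// exprn_ge0.
by rewrite sumEFin lee_fin -mulr_sumr ler_wpM2l// geometric_sum_le.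
Qed.

Context {dO : measure_display} {Omega : measurableType dO}.
Local Notation TR := (measurableTypeR R).
Variables (P : probability Omega R) (mu : probability TR R).
Variable A : nat -> set ((TR * Omega) * TR).
Variables (C1 rho sigma C b W : R).
Hypothesis mA : forall n, measurable (A n).
Hypothesis C1_gt0 : 0 < C1.
Hypothesis rho_gt0 : 0 < rho.
Hypothesis sigma_ge1 : 1 <= sigma.
Hypothesis C_gt0 : 0 < C.
Hypothesis b_gt0 : 0 < b.
Hypothesis sb_lt1 : sigma * b < 1.
Hypothesis W_gt0 : 0 < W.
Hypothesis Wr_lt1 : W * rho < 1.
Hypothesis A_diam : forall n u w v, A n ((u, w), v) -> `|u - v| <= 1.
Hypothesis PA : forall n j u v, 2^-1 ^+ j.+1 <= `|u - v| ->
  (P [set w | A n ((u, w), v)] <= (C1 * rho ^+ n * sigma ^+ j)%:E)%E.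
Hypothesis mu_ball : forall n (u : R),
  (mu [set v : R | (`|u - v| <= 2^-1 ^+ n)%R] <= (C * b ^+ n)%:E)%E.

Let closed_ball_ (u : R) j : set TR := [set v : R | (`|u - v| <= 2^-1 ^+ j)%R].

Let m_ball u j : measurable (closed_ball_ u j).
Proof.
rewrite (_ : closed_ball_ u j = `[u - 2^-1 ^+ j, u + 2^-1 ^+ j]%classic).
  exact: measurable_itv.
by apply/seteqP; split => v; rewrite /closed_ball_ /= in_itv/= distrC ler_distl.
Qed.

Let section_at u n : set (Omega * TR) := [set q | A n ((u, q.1), q.2)].

Let m_section_at u n : measurable (section_at u n).
Proof.
rewrite -[X in measurable X]setTI.
have mf : measurable_fun setT (fun q : Omega * TR => ((u, q.1), q.2)).
  apply: measurable_fun_pair => //; apply: measurable_fun_pair => //.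
by apply: mf.
Qed.

(** A majorant of the probability as a function of v, written with indicators of balls so that its
    integral against [mu] is a geometric series of ratio [sigma * b]. *)
Let scales n u v : \bar R :=
  (\sum_(0 <= j <oo) (C1 * rho ^+ n * sigma ^+ j)%:E * (\1_(closed_ball_ u j) v)%:E)%E.

Let coef_ge0 n j : 0 <= C1 * rho ^+ n * sigma ^+ j.
Proof.
by rewrite !mulr_ge0 ?exprn_ge0// ?ltW// (lt_le_trans ltr01).
Qed.

Let P_section_le u v n : (P (ysection (section_at u n) v) <= scales n u v)%E.
Proof.
have -> : ysection (section_at u n) v = [set w | A n ((u, w), v)].
  by apply/seteqP; split => w /=; rewrite /ysection/= in_setE.
have term_ge0 j : (0 <= (C1 * rho ^+ n * sigma ^+ j)%:E *
    (\1_(closed_ball_ u j) v)%:E)%E.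
  by rewrite mule_ge0 ?lee_fin// indicE.
have [->|/set0P[w0 /A_diam uv1]] := eqVneq [set w | A n ((u, w), v)] set0.
  by rewrite measure0; apply: nneseries_ge0 => j _ _.
(* On the diagonal [PA] says nothing, but all indicators are 1 and, as sigma >= 1, every term is at
   least C1 rho^n; enough of them exceed the trivial bound 1. *)
have [uv|uv] := eqVneq u v.
  have a0 : 0 < C1 * rho ^+ n by rewrite mulr_gt0// exprn_gt0.
  pose N := (Num.truncn (C1 * rho ^+ n)^-1).+1.
  apply: (@le_trans _ _ 1%E).
    apply: probability_le1; rewrite -[X in measurable X]setTI.
    have mf : measurable_fun setT (fun w : Omega => ((u, w), v) : (TR * Omega) * TR).
      by apply: measurable_fun_pair => //; apply: measurable_fun_pair.
    exact: mf.
  apply: le_trans (nneseries_lim_ge N _); last by move=> j _ _; exact: term_ge0.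
  apply: (@le_trans _ _ (\sum_(0 <= j < N) (C1 * rho ^+ n)%:E)%E).
    rewrite sumEFin lee_fin sumr_const_nat subn0 -mulr_natr -ler_pdivrMl//.
    by rewrite mulr1 ltW// truncnS_gt.
  apply: lee_sum => j _; rewrite indicE mem_set ?mule1 ?lee_fin; last first.
    by rewrite /closed_ball_ /= uv subrr normr0 exprn_ge0.
  by rewrite ler_peMr ?(ltW a0)// exprn_ege1.
have d0 : 0 < `|u - v| by rewrite normr_gt0 subr_eq0.
have [|j /andP[jP jle]] := @dyadic_scale _ `|u - v|; first by rewrite d0.
apply: le_trans (PA n jP) _.
apply: le_trans (nneseries_lim_ge j.+1 _); last by move=> i _ _; exact: term_ge0.
rewrite big_nat_recr//= indicE mem_set// mule1 leeDr//.
by apply: sume_ge0 => i _; exact: term_ge0.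
Qed.

Let C2 := C1 * C / (1 - sigma * b).

Let section_integral_le u n :
  (\int[P]_w mu (xsection (A n) (u, w)) <= (C2 * rho ^+ n)%:E)%E.
Proof.
have -> : (\int[P]_w mu (xsection (A n) (u, w)) =
    \int[P]_w (mu \o xsection (section_at u n)) w)%E.
  apply: eq_integral => w _ /=.
  suff -> : xsection (A n) (u, w) = xsection (section_at u n) w by [].
  by apply/seteqP; split => v; rewrite /xsection/= !in_setE.
rewrite -(indic_fubini_tonelli_FE mu (m_section_at u n)).
rewrite (indic_fubini_tonelli P mu (m_section_at u n)).
rewrite (indic_fubini_tonelli_GE P (m_section_at u n)).
have m_term j : measurable_fun setT (fun v : TR => ((C1 * rho ^+ n * sigma ^+ j)%:E *
    (\1_(closed_ball_ u j) v)%:E)%E).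
  apply: measurable_funeM; apply/measurable_EFinP; exact: measurable_indic.
apply: (@le_trans _ _ (\int[mu]_v scales n u v)%E).
  apply: ge0_le_integral => //.
  - exact: measurable_fun_ysection.
  - by apply: ge0_emeasurable_sum => // j v _ _; rewrite mule_ge0 ?lee_fin// indicE.
  - by move=> v _; exact: P_section_le.
rewrite integral_nneseries//; last first.
  by move=> j v _; rewrite mule_ge0 ?lee_fin// indicE.
have sb0 : 0 <= sigma * b by rewrite mulr_ge0 ?ltW// (lt_le_trans ltr01).
apply: (@le_trans _ _ (\sum_(0 <= j <oo) (C1 * rho ^+ n * C * (sigma * b) ^+ j)%:E)%E).
  apply: lee_nneseries => [j _ _|j _].
    by apply: integral_ge0 => v _; rewrite mule_ge0 ?lee_fin// indicE.
  rewrite ge0_integralZl_EFin//; last by apply/measurable_EFinP; exact: measurable_indic.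
  rewrite integral_indic// setIT.
  apply: (@le_trans _ _ ((C1 * rho ^+ n * sigma ^+ j)%:E * (C * b ^+ j)%:E)%E).
    by apply: lee_wpmul2l; [rewrite lee_fin|exact: mu_ball].
  by rewrite -EFinM lee_fin exprMn; rewrite le_eqVlt; apply/orP; left; apply/eqP; ring.
apply: le_trans (nneseries_geometric_le _ _) _.
- by rewrite !mulr_ge0 ?exprn_ge0// ltW.
- by rewrite sb0 sb_lt1.
- rewrite lee_fin /C2; rewrite le_eqVlt; apply/orP; left; apply/eqP; field; rewrite gt_eqF// subr_gt0.
exact: sb_lt1.
Qed.

(** The weights W^n grow slowly enough for a finite mean ([W * rho < 1]), and finiteness of [Z]
    bounds every section by a multiple of W^(-n), with one constant for all n. *)
Let Z (z : TR * Omega) : \bar R :=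
  (\sum_(0 <= n <oo) (W ^+ n)%:E * mu (xsection (A n) z))%E.

Let Zterm_ge0 n z : (0 <= (W ^+ n)%:E * mu (xsection (A n) z))%E.
Proof. by rewrite mule_ge0 ?lee_fin ?exprn_ge0// ltW. Qed.

Let Z_ge0 z : (0 <= Z z)%E.
Proof. by apply: nneseries_ge0 => n _ _; exact: Zterm_ge0. Qed.

Let m_N n : measurable_fun setT (fun z => mu (xsection (A n) z)).
Proof. exact: measurable_fun_xsection. Qed.

Let m_Z : measurable_fun setT Z.
Proof.
apply: ge0_emeasurable_sum => [n z _ _|n _]; first exact: Zterm_ge0.
by apply: measurable_funeM; exact: m_N.
Qed.

Let integral_Z_lty : (\int[mu \x P]_z Z z < +oo)%E.
Proof.
rewrite integral_nneseries//; last first.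
  by move=> n; apply: measurable_funeM; exact: m_N.
have C20 : 0 <= C2 by rewrite /C2 !mulr_ge0 ?invr_ge0 ?subr_ge0 ?ltW.
have Wr0 : 0 <= W * rho by rewrite mulr_ge0 ?ltW.
apply: (@le_lt_trans _ _ (C2 / (1 - W * rho))%:E); last exact: ltry.
apply: le_trans (nneseries_geometric_le C20 _); last by rewrite Wr0.
apply: lee_nneseries => [n _ _|n _].
  by apply: integral_ge0 => z _; exact: Zterm_ge0.
rewrite ge0_integralZl_EFin ?exprn_ge0 ?(ltW W_gt0)//.
rewrite fubini_tonelli1//.
apply: (@le_trans _ _ ((W ^+ n)%:E * (C2 * rho ^+ n)%:E)%E).
  rewrite lee_wpmul2l// ?lee_fin ?exprn_ge0 ?(ltW W_gt0)//.
  apply: (@le_trans _ _ (\int[mu]_u (C2 * rho ^+ n)%:E)%E).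
    apply: ge0_le_integral => //.
    - by move=> u _; apply: integral_ge0.
    - by apply: measurable_fun_fubini_tonelli_F => //; exact: m_N.
    - by move=> u _; exact: section_integral_le.
  rewrite integral_cst// -[leRHS]mule1; apply: lee_wpmul2l.
    by rewrite lee_fin mulr_ge0// exprn_ge0// ltW.
  exact: probability_le1.
by rewrite -EFinM lee_fin exprMn; rewrite le_eqVlt; apply/orP; left; apply/eqP; ring.
Qed.

(** For almost every w, [Z] is finite at mu-almost every time. Its sublevel sets then exhaust [K] up
    to a null set, so one of them has positive mass, and its level serves as [M]. *)
Lemma ae_uniform_sections : {ae P, forall w, forall K : set TR,
  measurable K -> (0 < mu K)%E -> exists (G : set TR) (M : R),
    [/\ G `<=` K, measurable G, (0 < mu G)%E, 0 <= M &
      forall u n, G u -> (mu [set v | A n ((u, w), v)] <= (M * (W^-1) ^+ n)%:E)%E]}.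
Proof.
have mG : measurable_fun setT (fubini_G mu Z).
  by apply: measurable_fun_fubini_tonelli_G; [exact: m_Z|exact: Z_ge0].
have G_ge0 w : (0 <= fubini_G mu Z w)%E by apply: integral_ge0.
have intG : P.-integrable setT (fubini_G mu Z).
  apply/integrableP; split => //.
  under eq_integral => w _ do rewrite gee0_abs//.
  by rewrite -fubini_tonelli2.
have := integrable_ae measurableT intG; apply: filterS => w /(_ I) Gw K mK K0.
have mz : measurable_fun setT (fun u : TR => Z (u, w)).
  exact: (measurableT_comp m_Z (pair2_measurable w)).
have intz : mu.-integrable setT (fun u : TR => Z (u, w)).
  apply/integrableP; split => //.
  under eq_integral => u _ do rewrite gee0_abs//.
  by rewrite ltey_eq Gw.
pose L k : set TR := K `&` [set u | (Z (u, w) <= k%:R%:E)%E].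
have mL k : measurable (L k).
  apply: measurableI => //; rewrite -[X in measurable X]setTI.
  exact: emeasurable_fun_infty_c.
have [k Lk] : exists k, (0 < mu (L k))%E.
  apply: contrapT => /forallNP H; move: K0; apply/negP; rewrite -leNgt.
  have K0 : mu.-negligible K.
    apply: (@negligibleS _ _ _ mu ((\bigcup_k L k) `|`
        [set u | ~ (setT u -> Z (u, w) \is a fin_num)])).
      move=> u Ku; have [fu|fu] := pselect (Z (u, w) \is a fin_num); last first.
        by right => /(_ I).
      left; exists (Num.truncn (fine (Z (u, w)))).+1 => //; split => //=.
      by rewrite -[Z _]fineK// lee_fin ltW// truncnS_gt.
    apply: negligibleU; last exact: integrable_ae.
    apply: negligible_bigcup => k; exists (L k); split => //.
    apply/eqP; rewrite eq_le measure_ge0 andbT leNgt.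
    by apply/negP; exact: H.
  by rewrite (measure_negligible mK K0).
exists (L k), k%:R; split => //.
- by move=> u [].
- move=> u n [_ /= Zk].
  have -> : [set v | A n (u, w, v)] = xsection (A n) (u, w).
    by apply/seteqP; split => v; rewrite /xsection/= in_setE.
  have : ((W ^+ n)%:E * mu (xsection (A n) (u, w)) <= k%:R%:E)%E.
    apply: le_trans Zk; apply: le_trans (nneseries_lim_ge n.+1 _).
      rewrite big_nat_recr//= leeDr//.
      by apply: sume_ge0 => i _; exact: Zterm_ge0.
    by move=> i _ _; exact: Zterm_ge0.
  have fm : mu (xsection (A n) (u, w)) \is a fin_num.
    by apply: fin_num_measure; exact: measurable_xsection.
  rewrite -[mu _]fineK// -EFinM !lee_fin => h.
  by rewrite exprVn ler_pdivlMr ?exprn_gt0// mulrC.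
Qed.

End random_sections.

(** * Mass distribution and the dimension of the image *)

Section mass_distribution.
Context {R : realType} {d : nat}.
Local Notation TR := (measurableTypeR R).

Lemma enorm_coord (x : 'rV[R]_d) i : `|x 0 i| <= enorm x.
Proof.
rewrite /enorm -sqrtr_sqr ler_wsqrtr// /dotrV (bigD1 i)//= -expr2 lerDl.
by apply: sumr_ge0 => j _; rewrite -expr2 sqr_ge0.
Qed.

Lemma enorm_coord_close (x y : 'rV[R]_d) r : enorm (x - y) <= r -> coord_close r x y.
Proof. by move=> xy i; have := enorm_coord (x - y) i; rewrite !mxE; lra. Qed.

(** Rounding a positive diameter up to a power of 2 costs at most the factor 2^g. A diameter 0 has
    no dyadic scale; the error [e] pays for it with n large. *)
Lemma dyadic_scale_gauge (g s e delta : R) : 0 < g -> 0 <= s <= g -> 0 < e ->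
  0 <= delta <= 1 ->
  exists2 n, delta <= 2^-1 ^+ n &
    (2 `^ (- g)) ^+ n <= 2 `^ g * delta `^ s + e.
Proof.
move=> g0 /andP[s0 sg] e0 /andP[]; rewrite le_eqVlt => /predU1P[<- _|d0 d1].
  have cv : (2 `^ (- g) : R) ^+ n @[n --> \oo] --> (0 : R).
    by apply: cvg_expr; rewrite ger0_norm ?powR_ge0// powR2N_lt1.
  have /cvgrPdist_le/(_ e e0)[n _ /(_ n (leqnn n))] := cv.
  rewrite /= sub0r normrN ger0_norm ?exprn_ge0 ?powR_ge0// => h.
  exists n; first by rewrite exprn_ge0.
  by apply: le_trans h _; rewrite lerDr mulr_ge0// powR_ge0.
have [|n /andP[n1 n2]] := @dyadic_scale _ delta; first by rewrite d0.
exists n => //; rewrite -half_powR.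
apply: (@le_trans _ _ ((2 * delta) `^ g)).
  apply: ge0_ler_powR; rewrite ?nnegrE ?exprn_ge0 ?mulr_ge0 ?(ltW d0) ?(ltW g0)//.
  by move: n1; rewrite exprS; lra.
rewrite powRM ?(ltW d0)//; apply: (@le_trans _ _ (2 `^ g * delta `^ s)).
  rewrite ler_wpM2l ?powR_ge0//.
  by apply: ger_powR => //; rewrite d0.
by rewrite lerDl ltW.
Qed.

(** If g exceeded the dimension, [phi @] E[would have covers of arbitrarily small gauge sum. A cover
    set that meets]phi @[G] at some [phi u] pulls back, within [G], into a measurable set [V u n] of
    comparable mass, so [G] itself would have too little mass. *)
Lemma mass_distribution (phi : R -> 'rV[R]_d) (mu : probability TR R)
    (E G : set R) (g M : R) (V : R -> nat -> set TR) :
  0 < g -> 0 <= M -> G `<=` E -> measurable (G : set TR) -> (0 < mu G)%E ->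
  (forall u n, measurable (V u n)) ->
  (forall u v n, G u -> G v -> coord_close (2^-1 ^+ n) (phi u) (phi v) -> V u n v) ->
  (forall u n, G u -> (mu (V u n) <= (M * (2 `^ (- g)) ^+ n)%:E)%E) ->
  (g%:E <= dimH_rV (phi @` E))%E.
Proof.
move=> g0 M0 GE mG muG mV VP muV.
apply: le_ereal_inf_tmp => _ [s [s0 Es] <-]; rewrite lee_fin leNgt; apply/negP => sg.
pose dist (x y : 'rV[R]_d) := enorm (x - y).
pose gauge A := hausdorff_gauge dist s A.
have gauge_ge0 A : (0 <= gauge A)%E by exact: hausdorff_gauge_ge0.
have fG : mu G \is a fin_num by exact: fin_num_measure.
pose m := fine (mu G).
have m0 : 0 < m by rewrite -lte_fin fineK.
have p0 : 0 < 2 `^ g :> R by rewrite powR_gt0.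
have K0 : 0 < M * 2 `^ g + M + 1.
  by rewrite ltr_wpDl// addr_ge0// mulr_ge0// ltW.
(* The cover will give mu G <= (M 2^g + M) e, where the second M collects the rounding errors; the
   extra 1 makes the contradiction strict. *)
have [e e0 eE] : exists2 e, 0 < e & (M * 2 `^ g + M + 1) * e = m.
  exists (m / (M * 2 `^ g + M + 1)); first by rewrite divr_gt0.
  by field; rewrite gt_eqF.
have [U [EU Ud Ue]] := (hausdorff_measure_eq0P _ _ _).1 Es e 1 e0 ltr01.
have /choice[W WP] i : exists W : set TR, [/\ measurable W,
    forall v, G v -> U i (phi v) -> W v &
    (mu W <= (M * 2 `^ g)%:E * gauge (U i) + (M * e / (2 ^ i.+1)%:R)%:E)%E].
  have [[u [Gu Uu]]|NU] := pselect (exists u, G u /\ U i (phi u)); last first.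
    exists set0; split => // [v Gv Uv|]; first by apply: NU; exists v.
    rewrite measure0; apply: adde_ge0.
      by apply: mule_ge0 => //; rewrite lee_fin mulr_ge0// ltW.
    by rewrite lee_fin divr_ge0// mulr_ge0// ltW.
  have dU0 := diameter_ge0 dist (U i).
  have fU : diameter dist (U i) \is a fin_num.
    by rewrite ge0_fin_numE// (le_lt_trans (Ud i))// ltry.
  pose delta := fine (diameter dist (U i)).
  have dE : diameter dist (U i) = delta%:E by rewrite /delta fineK.
  have d0 : 0 <= delta by rewrite fine_ge0.
  have d1 : delta <= 1 by rewrite -lee_fin -dE.
  have ei : 0 < e / (2 ^ i.+1)%:R by rewrite divr_gt0// ltr0n expn_gt0.
  have s0g : 0 <= s <= g by rewrite s0 ltW.
  have d01 : 0 <= delta <= 1 by rewrite d0.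
  have [n dn ng] := dyadic_scale_gauge g0 s0g ei d01.
  exists (V u n); split => //.
    move=> v Gv Uv; apply: VP => //; apply: enorm_coord_close.
    apply: le_trans dn; rewrite -lee_fin -dE.
    exact: le_diameter Uu Uv.
  apply: le_trans (muV u n Gu) _.
  have -> : gauge (U i) = (delta `^ s)%:E.
    rewrite /gauge /hausdorff_gauge dE; case: eqP => // U0.
    by rewrite U0 in Uu.
  rewrite -EFinM -EFinD lee_fin -!mulrA -mulrDr. apply: ler_wpM2l => //.
have : (mu G <= ((M * 2 `^ g + M) * e)%:E)%E.
  apply: (@le_trans _ _ (\sum_(0 <= i <oo) mu (W i))%E).
    apply: measure_sigma_subadditive => // [i|v Gv]; first by case: (WP i).
    have [i _ Ui] := EU (phi v) (ex_intro2 _ _ v (GE v Gv) erefl).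
    by exists i => //; case: (WP i) => _ + _; apply.
  apply: (@le_trans _ _ (\sum_(0 <= i <oo) ((M * 2 `^ g)%:E * gauge (U i) +
      (M * e / (2 ^ i.+1)%:R)%:E))%E).
    by apply: lee_nneseries => [i _ _|i _]; [exact: measure_ge0|case: (WP i)].
  apply: le_trans (epsilon_trick _ _ _) _.
  - by move=> i; rewrite mule_ge0// lee_fin mulr_ge0// ltW.
  - by rewrite mulr_ge0// ltW.
  rewrite nneseriesZl//.
  have -> : ((M * 2 `^ g + M) * e)%R%:E = ((M * 2 `^ g)%R%:E * e%:E + (M * e)%R%:E)%E.
    by rewrite -EFinM -EFinD mulrDl.
  apply: leeD => //.
  by apply: lee_wpmul2l => //; rewrite lee_fin mulr_ge0// ltW.
rewrite -[mu G]fineK// -/m lee_fin leNgt; move/negP; apply.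
by rewrite -eE ltr_pM2r// ltrDl.
Qed.

End mass_distribution.

(** * The almost sure lower bound for the dimension of the image *)

Section image_dimension.
Context {R : realType} {d : nat} {dO : measure_display}
  {Omega : measurableType dO}.
Variables (P : 'rV[R]_d -> probability Omega R) (X : R -> Omega -> 'rV[R]_d)
  (p : R -> 'rV[R]_d -> 'rV[R]_d -> R) (a c : R).
Hypothesis d_gt0 : (0 < d)%N.
Hypothesis fX : feller_process P X.
Hypothesis pX : transition_density P X p.
Hypothesis a_gt0 : 0 < a.
Hypothesis a_le : a <= d%:R.
Hypothesis c_gt0 : 0 < c.
Hypothesis p_le : forall t x y, 0 < t <= 1 -> p t x y <= c * t `^ (- (d%:R / a)).
Local Notation TR := (measurableTypeR R).

Definition close_times n : set ((TR * Omega) * TR) :=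
  [set z | [/\ 0 <= z.1.1 <= 1, 0 <= z.2 <= 1 &
     coord_close (2^-1 ^+ n) (X z.1.1 z.1.2) (X z.2 z.1.2)]].

Lemma measurable_close_times n : measurable (close_times n).
Proof.
pose Y i (z : TR * Omega) := X (Num.max z.1 0) z.2 0 i.
have mY i : measurable_fun setT (Y i).
  apply: (@measurable_right_continuous _ _ _ (fun t w => X t w 0 i)).
    by move=> t t0; exact: measurable_process_coord fX _ _ t0.
  move=> w t t0; have [+ _] := fp_cadlag fX w => /(_ t t0) h.
  exact: (cvg_comp _ _ h (@coord_continuous _ _ _ 0 i (X t w))).
pose Y1 i (z : (TR * Omega) * TR) := Y i z.1.
pose Y2 i (z : (TR * Omega) * TR) := Y i (z.2, z.1.2).
have mY1 i : measurable_fun setT (Y1 i) by exact: measurableT_comp.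
have mY2 i : measurable_fun setT (Y2 i).
  apply: measurableT_comp => //; apply: measurable_fun_pair => //.
  exact: measurableT_comp.
have mI : measurable (`[0, 1]%classic : set TR) by exact: measurable_itv.
have m1 : measurable_fun setT (fun z : (TR * Omega) * TR => z.1.1).
  exact: measurableT_comp.
rewrite (_ : close_times n = (fun z : (TR * Omega) * TR => z.1.1) @^-1` `[0, 1]%classic `&`
  (snd @^-1` `[0, 1]%classic `&` \bigcap_(i in [set: 'I_d])
    (fun z => `|Y1 i z - Y2 i z|) @^-1` `]-oo, 2^-1 ^+ n]%classic)); last first.
  have max0 (u : R) : 0 <= u <= 1 -> Num.max u 0 = u by move=> /andP[u0 _]; rewrite max_l.
  apply/seteqP; split => -[[u w] v].
    move=> [/= u01 v01 h]; split; first by rewrite /= in_itv.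
    split; first by rewrite /= in_itv.
    by move=> i _; rewrite /Y1 /Y2 /Y /= in_itv/= !max0//; exact: h.
  move=> [] /=; rewrite in_itv/= => u01 []; rewrite in_itv/= => v01 h; split => // i.
  by have := h i I; rewrite /Y1 /Y2 /Y /= in_itv/= !max0.
apply: measurableI; first by rewrite -[X in measurable X]setTI; exact: m1.
apply: measurableI; first by rewrite -[X in measurable X]setTI; exact: measurable_snd.
apply: fin_bigcap_measurable => // i _; rewrite -[X in measurable X]setTI.
have mi : measurable_fun setT (fun z => `|Y1 i z - Y2 i z|).
  by apply: measurableT_comp => //; exact: measurable_funB.
by apply: mi => //; exact: measurable_itv.
Qed.

Lemma lte_dense_fin (r : R) (y : \bar R) : (r%:E < y)%E ->
  exists2 s, r < s & (s%:E < y)%E.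
Proof.
case: y => [y|_|//]; last by exists (r + 1); [lra|exact: ltry].
by rewrite lte_fin => ry; exists ((r + y) / 2); rewrite ?lte_fin; lra.
Qed.

Lemma ae_dim_image_ge (E : set R) (g : R) x : analytic_set E -> E `<=` `[0, 1] ->
  0 < g -> (g%:E < a%:E * dimH_R E)%E ->
  {ae P x, forall w, (g%:E <= dimH_rV [set X t w | t in E])%E}.
Proof.
move=> anE E01 g0 gE.
have gaE : ((g / a)%:E < dimH_R E)%E.
  by rewrite -(@lte_pmul2l _ a%:E)// -EFinM mulrCA divff ?mulr1// gt_eqF.
have [s0 gs0 s0E] := lte_dense_fin gaE.
have ga0 : 0 < g / a by rewrite divr_gt0.
pose s1 := (g / a + s0) / 2; pose s2 := (g / a + s1) / 2.
have s10 : 0 < s1 < s0 by rewrite /s1; lra.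
have s12 : s2 < s1 by rewrite /s2 /s1; lra.
have gs2 : g / a < s2 by rewrite /s2 /s1; lra.
have Es0 : hausdorff_measure (fun x y : R => `|x - y|) s0 E != 0%E.
  apply: contraTN s0E => /eqP Es0; rewrite -leNgt; apply: ereal_inf_lbound.
  by exists s0 => //; split => //; lra.
have [K [mu [C [cK KE muK s11 [C0 muC]]]]] := frostman_analytic anE E01 s10 Es0.
have s20 : 0 < s2 <= 1 by apply/andP; split; lra.
have [C1 C10 Pclose] := close_prob_le d_gt0 fX pX a_gt0 a_le c_gt0 p_le s20.
pose b : R := 2 `^ (- s1).
have b0 : 0 < b by rewrite powR_gt0.
(* A closed ball of radius 2^(-n-1) fits in the half-open interval of radius 2^(-n), at the cost of
   a factor 1 / b; the summand 1 covers n = 0. *)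
pose C' := 1 + C / b.
have C'0 : 0 < C' by rewrite ltr_wpDr// divr_ge0// ltW.
have mball n (u : R) : (mu [set v : R | (`|u - v| <= 2^-1 ^+ n)%R] <= (C' * b ^+ n)%:E)%E.
  have E0 : [set v : R | `|u - v| <= 2^-1 ^+ n] =
      `[u - 2^-1 ^+ n, u + 2^-1 ^+ n]%classic.
    by apply/seteqP; split => v; rewrite /= in_itv/= distrC ler_distl.
  have mB : measurable ([set v : R | `|u - v| <= 2^-1 ^+ n] : set TR).
    by rewrite E0; exact: measurable_itv.
  case: n E0 mB => [|n] E0 mB.
    rewrite expr0 mulr1; apply: le_trans (probability_le1 mu mB) _.
    by rewrite lee_fin lerDl divr_ge0// ltW.
  apply: (@le_trans _ _ (mu `](u - 2^-1 ^+ n)%R, (u + 2^-1 ^+ n)%R]%classic)).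
    apply: le_measure; rewrite ?inE//.
    rewrite E0 => v; rewrite /= !in_itv/= exprS.
    by have : 0 < 2^-1 ^+ n :> R; [rewrite exprn_gt0|lra].
  apply: le_trans (muC n u) _; rewrite lee_fin -/b /C' exprS mulrDl mul1r.
  rewrite (_ : C / b * (b * b ^+ n) = C * b ^+ n); last by field; rewrite gt_eqF.
  by rewrite lerDr mulr_ge0// ?exprn_ge0// ltW.
(* [rho] and [sigma] are the rates of [close_prob_le] at s2; [W] is the inverse of the decay 2^(-g)
   wanted in [mass_distribution]. *)
pose rho : R := 2 `^ (- (a * s2)); pose sigma : R := 2 `^ s2; pose W : R := 2 `^ g.
have sigma1 : 1 <= sigma.
  rewrite -(powRr0 2); apply: ler_powR; first by rewrite ler1n.
  by apply: ltW; case/andP: s20.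
have sb1 : sigma * b < 1.
  rewrite /sigma /b -powRD ?pnatr_eq0 ?implybT// (_ : s2 + - s1 = - (s1 - s2)); last ring.
  by apply: powR2N_lt1; lra.
have Wr1 : W * rho < 1.
  rewrite /W /rho -powRD ?pnatr_eq0 ?implybT// -opprB.
  by apply: powR2N_lt1; move: gs2; rewrite ltr_pdivrMr// mulrC; lra.
have rho0 : 0 < rho by rewrite powR_gt0.
have W0 : 0 < W by rewrite powR_gt0.
have Adiam n u w v : close_times n ((u, w), v) -> `|u - v| <= 1.
  by move=> [/= /andP[? ?] /andP[? ?] _]; rewrite ler_norml; lra.
have PA n j u v : 2^-1 ^+ j.+1 <= `|u - v| ->
    (P x [set w | close_times n ((u, w), v)] <= (C1 * rho ^+ n * sigma ^+ j)%:E)%E.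
  move=> juv; have [u01|Nu] := boolP (0 <= u <= 1); last first.
    rewrite (_ : [set w | _] = set0) ?measure0 ?lee_fin ?mulr_ge0 ?exprn_ge0 ?powR_ge0 ?(ltW C10)//.
    by apply/seteqP; split => w // [/= u01]; rewrite u01 in Nu.
  have [v01|Nv] := boolP (0 <= v <= 1); last first.
    rewrite (_ : [set w | _] = set0) ?measure0 ?lee_fin ?mulr_ge0 ?exprn_ge0 ?powR_ge0 ?(ltW C10)//.
    by apply/seteqP; split => w // [/= _ v01]; rewrite v01 in Nv.
  rewrite (_ : [set w | _] = [set w | coord_close (2^-1 ^+ n) (X u w) (X v w)]).
    exact: Pclose.
  by apply/seteqP; split => w //= [].
have := ae_uniform_sections measurable_close_times C10 rho0 sigma1 C'0 b0 sb1 W0 Wr1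
  Adiam PA mball.
apply: filterS => w.
have mK : measurable (K : set TR).
  apply: closed_measurable; apply: compact_closed => //; exact: Rhausdorff.
have K0 : (0 < mu K)%E.
  rewrite lt_neqAle measure_ge0 andbT; apply/eqP => K0.
  have := probability_setC mu mK; rewrite [LHS]muK -[X in (_ - X)%E]K0 sube0.
  by move/eqP; rewrite eq_sym onee_eq0.
move=> /(_ K mK K0)[G [M [GK mG G0 M0 GM]]].
apply: (mass_distribution (mu := mu) (G := G) (M := M)
  (V := fun u n => [set v | close_times n ((u, w), v)])) => //.
- exact: subset_trans GK KE.
- move=> u n; rewrite -[X in measurable X]setTI.
  have mf : measurable_fun setT (fun v : TR => ((u, w), v) : (TR * Omega) * TR).
    by apply: measurable_fun_pair.
  by apply: mf => //; exact: measurable_close_times.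
- move=> u v n /GK/KE/E01 + /GK/KE/E01; rewrite /= !in_itv/= => u01 v01 uv.
  by split.
- by move=> u n Gu; rewrite powRN; exact: GM.
Qed.

Lemma hausdorff_dim_ge0 T (dist : T -> T -> R) A : (0 <= hausdorff_dim dist A)%E.
Proof. by apply: le_ereal_inf_tmp => _ [s [s0 _] <-]; rewrite lee_fin. Qed.

Lemma ae_dim_image (E : set R) x : analytic_set E -> E `<=` `[0, 1] ->
  {ae P x, forall w,
    (a%:E * dimH_R E <= dimH_rV [set X t w | t in E])%E}.
Proof.
move=> anE E01.
pose g n : R := if unpickle n is Some r then ratr (r : rat) else 0.
have : {ae P x, forall w, forall n, 0 < g n -> ((g n)%:E < a%:E * dimH_R E)%E ->
    ((g n)%:E <= dimH_rV [set X t w | t in E])%E}.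
  apply: ae_foralln => n.
  have [g0|g0] := boolP (0 < g n); last by apply: aeW.
  have [gE|gE] := boolP ((g n)%:E < a%:E * dimH_R E)%E; last by apply: aeW.
  by have := ae_dim_image_ge x anE E01 g0 gE; apply: filterS.
apply: filterS => w gw; rewrite leNgt; apply/negP.
set D := dimH_rV _ => DE.
have D0 : (0 <= D)%E by exact: hausdorff_dim_ge0.
have fD : D \is a fin_num by rewrite ge0_fin_numE// (lt_le_trans DE)// leey.
rewrite -[D]fineK// in DE.
have [r Dr rE] := lte_dense_fin DE.
have [q qP] := @rat_in_itvoo R _ _ Dr.
move: qP; rewrite in_itv/= => /andP[Dq qr].
have gq : g (pickle q) = ratr q by rewrite /g pickleK.
have := gw (pickle q); rewrite gq.
have q0 : 0 < ratr q :> R by apply: le_lt_trans Dq; exact: fine_ge0.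
have qE : ((ratr q)%:E < a%:E * dimH_R E)%E.
  by apply: lt_trans rE; rewrite lte_fin.
move=> /(_ q0 qE); rewrite -/D -[D]fineK// lee_fin leNgt.
by rewrite Dq.
Qed.

End image_dimension.

Theorem theorem1p4 (R : realType) (d : nat) (dO : measure_display)
    (Omega : measurableType dO) (P : 'rV[R]_d -> probability Omega R)
    (X : R -> Omega -> 'rV[R]_d) (q : 'rV[R]_d -> 'rV[R]_d -> R[i]) (c0 : R)
    (p : R -> 'rV[R]_d -> 'rV[R]_d -> R) (alpha c : R) :
  (0 < d)%N ->
  feller_process P X ->
  Cc_smooth `<=` generator_domain P X ->
  is_symbol P X q ->
  0 < c0 ->
  (forall x xi, ComplexField.Normc.normc (q x xi) <= c0 * (1 + enorm xi ^+ 2)) ->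
  (forall x, q x 0 = 0) ->
  transition_density P X p ->
  0 < alpha < 2 ->
  0 < c ->
  (forall t x y, 0 < t <= 1 -> p t x y <= c * t `^ (- (d%:R / alpha))) ->
  forall E : set R, E `<=` `[0, 1] -> analytic_set E ->
  forall x : 'rV[R]_d,
    {ae P x, forall w,
      ((Num.min alpha d%:R)%:E * dimH_R E <=
       dimH_rV [set X t w | t in E])%E}.
Proof.
move=> d0 fX _ _ _ _ _ pX /andP[alpha0 _] c_gt0 p_le E E01 anE x.
have d0' : 0 < d%:R :> R by rewrite ltr0n.
apply: (ae_dim_image (p := p) (c := c)) => //.
- by rewrite lt_min alpha0.
- by rewrite ge_min lexx orbT.
(* For t <= 1, lowering alpha makes the exponent more negative and hence weakens the bound. *)
- move=> t y z t01; apply: le_trans (p_le t y z t01) _.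
  rewrite ler_wpM2l ?(ltW c_gt0)//; apply: ger_powR => //.
  rewrite lerN2 ler_pM2l// lef_pV2 ?posrE ?lt_min ?alpha0//.
  by rewrite ge_min lexx.
Qed.
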